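(* Let $k=\mathbb{C}$ and $A=k[x,y]/(x^2,y^2)$, graded with $x$ in degree $0$ and $y$ in degree $-1$, viewed as a dg-algebra with zero differential. Let $S$ be the simple graded $A$-module of dimension one concentrated in degree $0$. Let $f_{-1}$ and $f_{-2}$ be nonzero elements of the one-dimensional spaces $\mathrm{Hom}_{A\text{-grstab}}(S,\Omega^{-1}S(1))$ and $\mathrm{Hom}_{A\text{-grstab}}(S,\Omega^{-2}S)$ respectively, regarded as morphisms $S\to S(2)$ in $A\text{-dgstab}$ via the isomorphisms $\Omega^{-1}S(1)\cong S(2)\cong\Omega^{-2}S$. Let $K$ be the cone of $g=f_{-1}+f_{-2}:S\to S(2)$ in $A\text{-dgstab}$. Then $K$ does not lie in the (essential) image of $F_A:\mathcal{C}(A)\to A\text{-dgstab}$. In particular, $F_A$ is not essentially surjective.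
   Context: Modules are right modules. $A\text{-grmod}$ is the category of finitely generated graded $A$-modules with degree $0$ homomorphisms; $X(n)^i=X^{n+i}$. $A\text{-grstab}$ has the objects of $A\text{-grmod}$, and its morphisms are those of $A\text{-grmod}$ modulo morphisms factoring through projectives; it is triangulated ($A$ is symmetric, hence self-injective). A dg-module over $A$ is a graded right $A$-module $X$ with a degree $1$ $A$-linear map $d_X$, $d_X^2=0$; $(X,d_X)(n)=(X(n),(-1)^n d_X)$. $D_{dg}(A)$ is the derived category of dg-modules, triangulated with shift $(1)$; $D^b_{dg}(A)$ is its full subcategory of objects isomorphic to finitely generated dg-modules; $D^{perf}_{dg}(A)$ is the thick subcategory generated by $A$. $A\text{-dgstab}:=D^b_{dg}(A)/D^{perf}_{dg}(A)$. A graded module is regarded as a dg-module with zero differential; this induces a functor $A\text{-grstab}\to A\text{-dgstab}$. Let $I=\ker(A\otimes_k A\to A)$ (kernel of multiplication) and $\Omega=-\otimes_A I$. $\Omega$ induces autoequivalences of $A\text{-grstab}$ (where it is the desuspension, $\Omega X$ being isomorphic to the kernel of a projective cover of $X$) and of $A\text{-dgstab}$. Replacing these categories by equivalent ones, $\Omega(1)$ is assumed to be an automorphism of each. $\mathcal{C}(A)$ has the objects of $A\text{-grstab}$, $\mathrm{Hom}_{\mathcal{C}(A)}(X,Y)=\bigoplus_{n}\mathrm{Hom}_{A\text{-grstab}}(X,\Omega^nY(n))$, and composition $(g_m)\circ(f_n)=\big(\sum_{i}\Omega^i g_{j-i}(i)\circ f_i\big)_{j}$. For a dg-module $X$, the sequence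 $0\to\Omega X\to X\otimes_kA\to X\to0$ gives a natural morphism $X\to\Omega X(1)$, invertible in $A\text{-dgstab}$; let $\psi_1:\Omega(1)\to\mathrm{id}$ be its inverse and $\{\psi_n:\Omega^n(n)\to\mathrm{id}_{A\text{-dgstab}}\}_{n\in\mathbb{Z}}$ the natural isomorphisms extending $\psi_1$ with $\psi_0=\mathrm{id}$, $\psi_m\circ(\psi_n\,\Omega^m(m))=\psi_{n+m}$. $F_A:\mathcal{C}(A)\to A\text{-dgstab}$ is the identity on objects and sends $(f_n)_n:X\to Y$ to $\sum_n\psi_{n,Y}\circ f_n$. The isomorphisms $\Omega^{-1}S(1)\cong S(2)\cong\Omega^{-2}S$ used in $A\text{-dgstab}$ are $\psi_{-1,S(2)}$ and $\psi_{-2,S(2)}$; thus $g$ is the image under $F_A$ of the morphism $S\to S(2)$ of $\mathcal{C}(A)$ with components $f_{-1}$ in degree $-1$, $f_{-2}$ in degree $-2$, and $0$ elsewhere. *)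

(* Defs.v *)
From HB Require Import structures.
From mathcomp Require Import all_boot all_order all_algebra ssrAC.

Set Implicit Arguments.
Unset Strict Implicit.
Unset Printing Implicit Defensive.

Import GRing.Theory.
Local Open Scope ring_scope.

(* R[t]/(t^2); A = (k[x]/(x^2))[y]/(y^2).  The library's quotient {poly %/ p}
   stores remainders, so [tcoef j] reads off the coefficient of t^j. *)
Definition trunc (R : comNzRingType) := {poly %/ ('X^2 : {poly R})}.
HB.instance Definition _ (R : comNzRingType) := GRing.ComNzRing.on (trunc R).

Section Trunc.
Variable R : comNzRingType.
Implicit Types (p q : trunc R) (c : R).

Definition tcoef (j : nat) (p : trunc R) : R := (p : {poly R})`_j.
Definition tC (c : R) : trunc R := qpolyC _ c.
Definition tX : trunc R := qpolyX _.

Lemma mk_monic_X2 : mk_monic 'X^2 = 'X^2 :> {poly R}.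
Proof. by rewrite mk_monic_Xn. Qed.

Lemma tcoefM p q j : (j < 2)%N ->
  tcoef j (p * q) = \sum_(i < j.+1) tcoef i p * tcoef (j - i) q.
Proof.
move=> j2; rewrite /tcoef poly_of_qpolyM -coefM.
move: (_ * _ : {poly R}) => r; rewrite mk_monic_X2.
rewrite [in RHS](Pdiv.RingMonic.rdivp_eq (monicXn R 2) r).
by rewrite coefD coefMXn j2 add0r.
Qed.

Lemma tcoefM0 p q : tcoef 0 (p * q) = tcoef 0 p * tcoef 0 q.
Proof. by rewrite tcoefM // big_ord1. Qed.

Lemma tcoefM1 p q :
  tcoef 1 (p * q) = tcoef 0 p * tcoef 1 q + tcoef 1 p * tcoef 0 q.
Proof. by rewrite tcoefM // big_ord_recl big_ord1. Qed.

Lemma tcoefD j p q : tcoef j (p + q) = tcoef j p + tcoef j q.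
Proof. by rewrite /tcoef poly_of_qpolyD coefD. Qed.

Lemma tcoefN j p : tcoef j (- p) = - tcoef j p.
Proof. by rewrite /tcoef /= coefN. Qed.

Lemma tcoef_0 j : tcoef j 0 = 0.
Proof. by rewrite /tcoef /= coef0. Qed.

Lemma tcoefC j c : tcoef j (tC c) = if j == 0%N then c else 0.
Proof. by rewrite /tcoef qpolyCE coefC. Qed.

Lemma tcoef_1 j : tcoef j 1 = (j == 0%N)%:R.
Proof. by rewrite /tcoef /= coefC; case: eqP. Qed.

Lemma tcoefX j : tcoef j tX = (j == 1%N)%:R.
Proof. by rewrite /tcoef qpolyXE ?size_polyXn ?monicXn // coefX. Qed.

Lemma tcoef_big p j : (1 < j)%N -> tcoef j p = 0.
Proof. by move=> j1; apply: big_coef_npoly; rewrite mk_monic_X2 size_polyXn. Qed.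

Lemma trunc_eqP p q : tcoef 0 p = tcoef 0 q -> tcoef 1 p = tcoef 1 q -> p = q.
Proof. by move=> h0 h1; apply/npolyP => -[|[|i]] //; rewrite -!/(tcoef _ _) !tcoef_big. Qed.

End Trunc.

Definition A (k : fieldType) := trunc (trunc k).
HB.instance Definition _ (k : fieldType) := GRing.ComNzRing.on (A k).

(* the coefficient of x^i y^j.  These constants are locked because unification
   would otherwise compute in the quotient rings. *)
HB.lock Definition coefA (k : fieldType) (i j : nat) (a : A k) : k :=
  tcoef i (tcoef j a).

HB.lock Definition scal (k : fieldType) (c : k) : A k := tC (tC c).
HB.lock Definition Ax (k : fieldType) : A k := tC (tX k).
HB.lock Definition Ay (k : fieldType) : A k := tX (trunc k).

Section Monomials.
Variable k : fieldType.
Implicit Types (a b : A k) (c d : k).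
Local Notation Ax := (Ax k).
Local Notation Ay := (Ay k).
Local Notation scal := (@scal k).

(* x has degree 0 and y has degree -1 *)
Definition homA (n : int) (a : A k) : Prop :=
  forall i j, coefA i j a != 0 -> n = - j%:Z.

Lemma coefA_eqP a b : coefA 0 0 a = coefA 0 0 b -> coefA 1 0 a = coefA 1 0 b ->
  coefA 0 1 a = coefA 0 1 b -> coefA 1 1 a = coefA 1 1 b -> a = b.
Proof. by rewrite coefA.unlock => *; apply: trunc_eqP; apply: trunc_eqP. Qed.

Lemma coefA_big i j a : (1 < i)%N || (1 < j)%N -> coefA i j a = 0.
Proof.
rewrite coefA.unlock; case/orP=> h; first exact: tcoef_big.
by rewrite (tcoef_big _ h) tcoef_0.
Qed.

Lemma coefAD i j a b : coefA i j (a + b) = coefA i j a + coefA i j b.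
Proof. by rewrite coefA.unlock !tcoefD. Qed.
Lemma coefAN i j a : coefA i j (- a) = - coefA i j a.
Proof. by rewrite coefA.unlock !tcoefN. Qed.
Lemma coefA_0 i j : coefA i j (0 : A k) = 0.
Proof. by rewrite coefA.unlock !tcoef_0. Qed.
Lemma coefA_1 i j : coefA i j (1 : A k) = ((i == 0%N) && (j == 0%N))%:R.
Proof.
by rewrite coefA.unlock tcoef_1; case: eqP => _; rewrite ?tcoef_1 ?tcoef_0 ?andbT ?andbF.
Qed.

Definition coefAM00 a b : coefA 0 0 (a * b) = coefA 0 0 a * coefA 0 0 b.
Proof. by rewrite coefA.unlock !tcoefM0. Qed.
Definition coefAM10 a b : coefA 1 0 (a * b) =
  coefA 0 0 a * coefA 1 0 b + coefA 1 0 a * coefA 0 0 b.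
Proof. by rewrite coefA.unlock tcoefM0 tcoefM1. Qed.
Definition coefAM01 a b : coefA 0 1 (a * b) =
  coefA 0 0 a * coefA 0 1 b + coefA 0 1 a * coefA 0 0 b.
Proof. by rewrite coefA.unlock tcoefM1 tcoefD !tcoefM0. Qed.
Definition coefAM11 a b : coefA 1 1 (a * b) =
  coefA 0 0 a * coefA 1 1 b + coefA 1 0 a * coefA 0 1 b +
  (coefA 0 1 a * coefA 1 0 b + coefA 1 1 a * coefA 0 0 b).
Proof. by rewrite coefA.unlock tcoefM1 tcoefD !tcoefM1. Qed.
Definition coefAM := (coefAM00, coefAM10, coefAM01, coefAM11).

Lemma coef_scal i j c :
  coefA i j (scal c) = if (i == 0%N) && (j == 0%N) then c else 0.
Proof.
rewrite coefA.unlock scal.unlock tcoefC; case: (j == 0%N); last by rewrite tcoef_0 andbF.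
by rewrite tcoefC andbT.
Qed.
Lemma coef_Ax i j : coefA i j Ax = ((i == 1%N) && (j == 0%N))%:R.
Proof.
rewrite coefA.unlock Ax.unlock tcoefC; case: (j == 0%N); last by rewrite tcoef_0 andbF.
by rewrite tcoefX andbT.
Qed.
Lemma coef_Ay i j : coefA i j Ay = ((i == 0%N) && (j == 1%N))%:R.
Proof.
rewrite coefA.unlock Ay.unlock tcoefX; case: (j == 1%N); last by rewrite tcoef_0 andbF.
by rewrite tcoef_1 andbT.
Qed.

Definition coefAE :=
  (coef_scal, coef_Ax, coef_Ay, coefAM, coefAD, coefAN, coefA_1, coefA_0).

Lemma scal1 : scal 1 = 1.
Proof. by apply: coefA_eqP; rewrite coef_scal coefA_1. Qed.
Lemma scal0 : scal 0 = 0.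
Proof. by apply: coefA_eqP; rewrite coef_scal coefA_0. Qed.
Lemma scalD c d : scal (c + d) = scal c + scal d.
Proof. by apply: coefA_eqP; rewrite !coefAE /= ?addr0. Qed.
Lemma scalN1 : scal (- 1) = - 1.
Proof. by apply/eqP; rewrite eq_sym -subr_eq0 -opprD oppr_eq0 -scal1 -scalD addrN scal0. Qed.
Lemma scalM c d : scal (c * d) = scal c * scal d.
Proof. by apply: coefA_eqP;
  rewrite !coefAE /= ?(mulr0, mul0r, mulr1, mul1r, addr0, add0r). Qed.
Lemma Ax2 : Ax * Ax = 0.
Proof. by apply: coefA_eqP;
  rewrite !coefAE /= ?(mulr0, mul0r, mulr1, mul1r, addr0, add0r). Qed.
Lemma Ay2 : Ay * Ay = 0.
Proof. by apply: coefA_eqP;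
  rewrite !coefAE /= ?(mulr0, mul0r, mulr1, mul1r, addr0, add0r). Qed.
Lemma A_basis a : a = scal (coefA 0 0 a) + scal (coefA 1 0 a) * Ax +
  scal (coefA 0 1 a) * Ay + scal (coefA 1 1 a) * (Ax * Ay).
Proof.
by apply: coefA_eqP;
  rewrite !coefAE /= ?(mulr0, mul0r, mulr1, mul1r, addr0, add0r).
Qed.

Lemma A_mul_basis a :
  [/\ a * Ax = scal (coefA 0 0 a) * Ax + scal (coefA 0 1 a) * (Ax * Ay),
      a * Ay = scal (coefA 0 0 a) * Ay + scal (coefA 1 0 a) * (Ax * Ay) &
      a * (Ax * Ay) = scal (coefA 0 0 a) * (Ax * Ay)].
Proof.
by split; apply: coefA_eqP;
  rewrite !coefAE /= ?(mulr0, mul0r, mulr1, mul1r, addr0, add0r).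
Qed.

Lemma homA_scal c : homA 0 (scal c).
Proof. by move=> i j; rewrite coef_scal; case: andP => [[_ /eqP ->]|]; rewrite ?eqxx. Qed.
Lemma homA_Ax : homA 0 Ax.
Proof. by move=> i j; rewrite coef_Ax; case: andP => [[_ /eqP ->]|]; rewrite ?eqxx. Qed.
Lemma homA_Ay : homA (-1) Ay.
Proof. by move=> i j; rewrite coef_Ay; case: andP => [[_ /eqP ->]|]; rewrite ?eqxx. Qed.

End Monomials.

(* A is commutative, so right and left A-modules agree.  The grading is given
   by the projections [pr n] onto the homogeneous components
   X^n = {v | pr n v = v}; [pr_act] says that X^m A^n is contained in X^(m+n). *)
Record grmod (k : fieldType) := GrMod {
  gcar :> lmodType (A k);
  pr : int -> gcar -> gcar;
  pr_zmod : forall n, zmod_morphism (pr n);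
  prK : forall m n v, pr m (pr n v) = if m == n then pr n v else 0;
  pr_sum : forall v, exists2 s : seq int, uniq s & v = \sum_(n <- s) pr n v;
  pr_act : forall m n (a : A k) v, homA n a -> pr (m + n) (a *: v) = a *: pr m v
}.

HB.instance Definition _ (k : fieldType) (X : grmod k) (n : int) :=
  GRing.isZmodMorphism.Build X X (@pr k X n) (@pr_zmod k X n).

Record grhom (k : fieldType) (X Y : grmod k) := GrHom {
  gfun :> X -> Y;
  gfun_lin : linear gfun;
  gfun_pr : forall n v, pr n (gfun v) = gfun (pr n v)
}.

HB.instance Definition _ (k : fieldType) (X Y : grmod k) (f : grhom X Y) :=
  GRing.isLinear.Build (A k) X Y *:%R f (gfun_lin f).

Definition fingen (k : fieldType) (V : lmodType (A k)) : Prop :=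
  exists s : seq V, forall v, exists c : nat -> A k,
    v = \sum_(i < size s) c i *: s`_i.

Section GradedModules.
Variable k : fieldType.
Implicit Types X Y Z : grmod k.

Lemma pr_scal X n (c : k) (v : X) : pr n (scal c *: v) = scal c *: pr n v.
Proof. by rewrite -[in LHS](addr0 n) pr_act //; apply: homA_scal. Qed.
Lemma pr_x X n (v : X) : pr n (Ax k *: v) = Ax k *: pr n v.
Proof. by rewrite -[in LHS](addr0 n) pr_act //; apply: homA_Ax. Qed.
Lemma pr_y X n (v : X) : pr n (Ay k *: v) = Ay k *: pr (n + 1) v.
Proof. by rewrite -[in LHS](addrK 1 n) pr_act //; apply: homA_Ay. Qed.

Lemma gshift_sum X (n : int) (v : X) :
  exists2 s : seq int, uniq s & v = \sum_(i <- s) pr (n + i) v.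
Proof.
have [s us {1}->] := pr_sum v; exists [seq i - n | i <- s].
  by rewrite map_inj_uniq // => i j /addIr.
by rewrite big_map; apply: eq_bigr => i _; rewrite addrC subrK.
Qed.

(* X(n)^i = X^(n+i) *)
Definition gshift (n : int) X : grmod k.
Proof.
refine (@GrMod k X (fun i => @pr k X (n + i)) _ _ (gshift_sum n) _).
- by move=> i; apply: pr_zmod.
- by move=> i j v; rewrite prK (inj_eq (addrI n)).
- by move=> i j a v ha; rewrite addrA pr_act.
Defined.

Definition gid X : grhom X X.
Proof. by exists id. Defined.

Definition gcomp X Y Z (g : grhom Y Z) (f : grhom X Y) : grhom X Z.
Proof.
exists (fun v => g (f v)); first by move=> a u v /=; rewrite !linearP.
by move=> n v /=; rewrite !gfun_pr.
Defined.

Definition gzero X Y : grhom X Y.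
Proof.
exists (fun=> 0); first by move=> a u v; rewrite scaler0 addr0.
by move=> n v /=; rewrite raddf0.
Defined.

Definition gadd X Y (f g : grhom X Y) : grhom X Y.
Proof.
exists (fun v => f v + g v).
  by move=> a u v /=; rewrite !linearP scalerDr addrACA.
by move=> n v /=; rewrite raddfD /= !gfun_pr.
Defined.

Definition gscale X Y (c : k) (f : grhom X Y) : grhom X Y.
Proof.
exists (fun v => scal c *: f v).
  by move=> a u v /=; rewrite linearP scalerDr !scalerA mulrC.
by move=> n v /=; rewrite pr_scal gfun_pr.
Defined.

Definition gshift_hom (n : int) X Y (f : grhom X Y) :
    grhom (gshift n X) (gshift n Y) :=
  @GrHom k (gshift n X) (gshift n Y) f (gfun_lin f)
    (fun i => gfun_pr f (n + i)).

Lemma pr_sum_ext X (v : X) : exists s : seq int, forall s', uniq s' ->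
  {subset s <= s'} -> v = \sum_(n <- s') pr n v.
Proof.
have [s us ev] := pr_sum v; exists s => s' us' ss'.
rewrite (bigID (mem s)) /= [X in _ + X]big1 ?addr0.
  rewrite -big_filter {1}ev; apply: perm_big; apply: uniq_perm => //.
    exact: filter_uniq.
  by move=> n; rewrite mem_filter; apply/idP/andP => [ns|[]] //; split => //; apply: ss'.
move=> n ns; rewrite ev raddf_sum big_seq big1 // => m ms.
by rewrite /= prK; case: eqP => // nm; rewrite nm /= ms in ns.
Qed.

Lemma gsum_sum X Y (v : X * Y) : exists2 s : seq int, uniq s &
  v = \sum_(n <- s) (pr n v.1, pr n v.2).
Proof.
have [s h] := pr_sum_ext v.1; have [s' h'] := pr_sum_ext v.2.
exists (undup (s ++ s')); first exact: undup_uniq.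
case: v h h' => v w /= h h'; apply/eqP; rewrite -pair_eqE /pair_eq /=.
by rewrite (raddf_sum fst) (raddf_sum snd) /= -h -?h' ?eqxx ?undup_uniq //
  => n ns; rewrite mem_undup mem_cat ns ?orbT.
Qed.

Definition gsum X Y : grmod k.
Proof.
refine (@GrMod k (X * Y)%type (fun n v => (pr n v.1, pr n v.2)) _ _
  (@gsum_sum X Y) _).
- by move=> n u v; rewrite /= !raddfB.
- by move=> m n v; rewrite /= !prK; case: eqP.
- by move=> m n a v ha; rewrite /= !pr_act.
Defined.

End GradedModules.

(* V (x)_k A, as sums of v00 (x) 1 + v10 (x) x + v01 (x) y + v11 (x) xy,
   with A acting on the right-hand factor. *)
Record tens (k : fieldType) (V : lmodType (A k)) :=
  Tens { t00 : V; t10 : V; t01 : V; t11 : V }.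

Section Tensor.
Variables (k : fieldType) (V : lmodType (A k)).
Implicit Types t u : tens V.

Definition tens_tup t := (t00 t, t10 t, t01 t, t11 t).
Definition tup_tens (p : V * V * V * V) :=
  Tens p.1.1.1 p.1.1.2 p.1.2 p.2.
Lemma tens_tupK : cancel tens_tup tup_tens. Proof. by case. Qed.
HB.instance Definition _ := Choice.copy (tens V) (can_type tens_tupK).

Definition tens_add t u :=
  Tens (t00 t + t00 u) (t10 t + t10 u) (t01 t + t01 u) (t11 t + t11 u).
Definition tens_opp t := Tens (- t00 t) (- t10 t) (- t01 t) (- t11 t).
Fact tens_addA : associative tens_add.
Proof. by move=> t u v; congr Tens; apply: addrA. Qed.
Fact tens_addC : commutative tens_add.
Proof. by move=> t u; congr Tens; apply: addrC. Qed.
Fact tens_add0 : left_id (Tens 0 0 0 0) tens_add.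
Proof. by case=> *; congr Tens; apply: add0r. Qed.
Fact tens_addN : left_inverse (Tens 0 0 0 0) tens_opp tens_add.
Proof. by case=> *; congr Tens; apply: addNr. Qed.
HB.instance Definition _ := GRing.isZmodule.Build (tens V)
  tens_addA tens_addC tens_add0 tens_addN.

Definition tens_act (a : A k) t :=
  let s i j v := scal (coefA i j a) *: v in
  Tens (s 0 0 (t00 t)) (s 0 0 (t10 t) + s 1 0 (t00 t))
       (s 0 0 (t01 t) + s 0 1 (t00 t))
       (s 0 0 (t11 t) + s 1 0 (t01 t) + s 0 1 (t10 t) + s 1 1 (t00 t)).
Fact tens_actA (a b : A k) t : tens_act a (tens_act b t) = tens_act (a * b) t.
Proof.
rewrite /tens_act /= !coefAM; move: (coefA 0 0 a) (coefA 1 0 a) (coefA 0 1 a)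
  (coefA 1 1 a) (coefA 0 0 b) (coefA 1 0 b) (coefA 0 1 b) (coefA 1 1 b).
move=> a0 a1 a2 a3 b0 b1 b2 b3.
congr Tens; rewrite !(scalerDr, scalD, scalM, scalerDl, scalerA, addrA) //.
by rewrite [LHS](ACl (1*2*5*3*7*4*6*8*9)).
Qed.
Fact tens_act1 : left_id 1 tens_act.
Proof.
case=> *; rewrite /tens_act !coefA_1 /= mulr0n mulr1n !scal0 !scal1.
by congr Tens; rewrite ?scale0r ?addr0 scale1r.
Qed.
Fact tens_actDr : right_distributive tens_act +%R.
Proof.
move=> a t u; congr Tens; rewrite /= !scalerDr ?addrA //.
- by rewrite [LHS](ACl (1*3*2*4)).
- by rewrite [LHS](ACl (1*3*2*4)).
- by rewrite [LHS](ACl (1*3*5*7*2*4*6*8)).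
Qed.
Fact tens_actDl t : {morph tens_act^~ t : a b / a + b}.
Proof.
move=> a b; congr Tens; rewrite /= !coefAD !scalD !scalerDl ?addrA //.
- by rewrite [LHS](ACl (1*3*2*4)).
- by rewrite [LHS](ACl (1*3*2*4)).
- by rewrite [LHS](ACl (1*3*5*7*2*4*6*8)).
Qed.
HB.instance Definition _ := GRing.Zmodule_isLmodule.Build (A k) (tens V)
  tens_actA tens_act1 tens_actDr tens_actDl.

Definition tens_mul (t : tens V) : V :=
  t00 t + Ax k *: t10 t + Ay k *: t01 t + (Ax k * Ay k) *: t11 t.
Fact tens_mul_lin : linear tens_mul.
Proof.
suff hZ a t : tens_mul (a *: t) = a *: tens_mul t.
  move=> a t u; rewrite -hZ; move: (a *: t) => v.
  by rewrite /tens_mul /= !scalerDr !addrA [LHS](ACl (1*3*5*7*2*4*6*8)).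
have [hx hy hxy] := A_mul_basis a.
rewrite /tens_mul /= !scalerDr !scalerA hx hy hxy [in a *: t00 t](A_basis a).
rewrite !scalerDl ![_ * scal _]mulrC !addrA.
by rewrite [LHS](ACl (1*3*5*9*2*8*4*7*6)).
Qed.
HB.instance Definition _ :=
  GRing.isLinear.Build (A k) (tens V) V *:%R tens_mul tens_mul_lin.

Definition omega_pred (t : tens V) := tens_mul t == 0.
Fact omega_closed : submod_closed omega_pred.
Proof.
split=> [|a t u /eqP ht /eqP hu]; apply/eqP; first exact: raddf0.
by rewrite linearP /= ht hu scaler0 addr0.
Qed.
HB.instance Definition _ :=
  GRing.isSubmodClosed.Build (A k) (tens V) omega_pred omega_closed.

Record omega := Omega { oval :> tens V; ovalP : oval \in omega_pred }.
HB.instance Definition _ := [isSub for oval].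
HB.instance Definition _ := [Choice of omega by <:].
HB.instance Definition _ := [SubChoice_isSubLmodule of omega by <:].
End Tensor.

Section Omega.
Variable k : fieldType.
Implicit Types X Y : grmod k.

Lemma homA_coef X (m n : int) (a : A k) i j (v : X) : homA n a ->
  scal (coefA i j a) *: pr (m + n) v = scal (coefA i j a) *: pr (m - j%:Z) v.
Proof.
by move=> /(_ i j) h; have [->|/h ->//] := eqVneq (coefA i j a) 0; rewrite scal0 !scale0r.
Qed.

(* X^n (x) x^i y^j has degree n - j *)
Definition tens_pr X (n : int) (t : tens X) : tens X :=
  Tens (pr n (t00 t)) (pr n (t10 t)) (pr (n + 1) (t01 t)) (pr (n + 1) (t11 t)).

Lemma tens_sum X (t : tens X) : exists2 s : seq int, uniq s &
  t = \sum_(n <- s) tens_pr n t.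
Proof.
have [s0 h0] := pr_sum_ext (t00 t); have [s1 h1] := pr_sum_ext (t10 t).
have [s2 h2] := pr_sum_ext (X := gshift 1 X) (t01 t).
have [s3 h3] := pr_sum_ext (X := gshift 1 X) (t11 t).
set s := undup (s0 ++ s1 ++ s2 ++ s3); exists s; first exact: undup_uniq.
have us : uniq s by apply: undup_uniq.
have -> : \sum_(n <- s) tens_pr n t =
  Tens (\sum_(n <- s) pr n (t00 t)) (\sum_(n <- s) pr n (t10 t))
   (\sum_(n <- s) pr (n + 1) (t01 t)) (\sum_(n <- s) pr (n + 1) (t11 t)).
  by elim: (s) => [|n r IH]; rewrite ?big_nil // !big_cons IH.
rewrite -h0 -?h1 //; try by move=> n ns; rewrite mem_undup !mem_cat ns ?orbT.
have e (v : X) : \sum_(n <- s) pr (n + 1) v = \sum_(n <- s) @pr k (gshift 1 X) n v.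
  by apply: eq_bigr => n _; rewrite /= addrC.
rewrite !e -h2 -?h3 //; try by move=> n ns; rewrite mem_undup !mem_cat ns ?orbT.
by case: (t).
Qed.

Definition gtens X : grmod k.
Proof.
refine (@GrMod k (tens X) (@tens_pr X) _ _ (@tens_sum X) _).
- by move=> n t u; congr Tens; rewrite /= raddfB.
- move=> m n t; rewrite /tens_pr /= !prK (inj_eq (addIr 1)).
  by case: eqP.
- move=> m n a t ha; congr Tens; rewrite /= ?raddfD /= ?(addrAC m n) !pr_scal;
    by rewrite !(homA_coef _ _ _ _ ha) ?subr0 ?addrK.
Defined.

Lemma omega_prP X (n : int) (t : omega X) : tens_pr n t \in omega_pred (V := X).
Proof.
have := ovalP t; rewrite /omega_pred /in_mem /= => /eqP h.
apply/eqP; rewrite -[RHS](raddf0 (@pr k X n)) -h /tens_mul !raddfD /=.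
by rewrite -!scalerA !(pr_x, pr_y).
Qed.

Definition omega_pr X (n : int) (t : omega X) : omega X := Omega (omega_prP n t).

Lemma omega_sum X (t : omega X) : exists2 s : seq int, uniq s &
  t = \sum_(n <- s) omega_pr n t.
Proof.
have [s us e] := tens_sum t; exists s => //.
by apply: val_inj; rewrite (raddf_sum (\val : omega X -> tens X)) /= -e.
Qed.

(* X (x)_A I, identified with the kernel of X (x)_k A -> X *)
Definition gomega X : grmod k.
Proof.
refine (@GrMod k (omega X) (@omega_pr X) _ _ (@omega_sum X) _).
- by move=> n t u; apply: val_inj; apply: (@pr_zmod k (gtens X)).
- move=> m n t; apply: val_inj; rewrite [LHS](@prK k (gtens X) m n (oval t)).
  by case: eqP.
- by move=> m n a t ha; apply: val_inj; apply: (@pr_act k (gtens X)).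
Defined.

Definition tens_map X Y (f : X -> Y) (t : tens X) : tens Y :=
  Tens (f (t00 t)) (f (t10 t)) (f (t01 t)) (f (t11 t)).

Definition gtens_hom X Y (f : grhom X Y) : grhom (gtens X) (gtens Y).
Proof.
refine (@GrHom k (gtens X) (gtens Y) (tens_map f) _ _).
  move=> a t u; rewrite /tens_map /= !linearD /= !linearZ /=.
  by congr Tens; rewrite ?linearD /= !linearZ.
by move=> n t; rewrite /= /tens_pr /tens_map /= !gfun_pr.
Defined.

Lemma tens_mul_nat X Y (f : grhom X Y) (t : tens X) :
  tens_mul (tens_map f t) = f (tens_mul t).
Proof. by rewrite /tens_mul /= !linearD /= !linearZ. Qed.

Lemma omega_mapP X Y (f : grhom X Y) (t : omega X) :
  tens_map f t \in omega_pred (V := Y).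
Proof.
have := ovalP t; rewrite /omega_pred /in_mem /= => /eqP h.
by rewrite tens_mul_nat h raddf0.
Qed.

Definition gomega_hom X Y (f : grhom X Y) : grhom (gomega X) (gomega Y).
Proof.
refine (@GrHom k (gomega X) (gomega Y) (fun t => Omega (omega_mapP f t)) _ _).
  by move=> a t u; apply: val_inj; apply: (gfun_lin (gtens_hom f)).
by move=> n t; apply: val_inj; apply: (gfun_pr (gtens_hom f)).
Defined.

Definition gomega_inc X : grhom (gomega X) (gtens X).
Proof. by refine (@GrHom k (gomega X) (gtens X) (@oval k X) _ _). Defined.

Definition gtens_mul X : grhom (gtens X) X.
Proof.
refine (@GrHom k (gtens X) X (@tens_mul k X) (@tens_mul_lin k X) _).
by move=> n t; rewrite /tens_mul !raddfD /= -!scalerA !(pr_x, pr_y).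
Defined.

Definition in_span (V : lmodType (A k)) (s : seq V) (v : V) :=
  exists c : nat -> A k, v = \sum_(i < size s) c i *: s`_i.

Lemma in_spanD (V : lmodType (A k)) (s : seq V) u v :
  in_span s u -> in_span s v -> in_span s (u + v).
Proof.
move=> [c ->] [d ->]; exists (fun i => c i + d i); rewrite -big_split /=.
by apply: eq_bigr => i _; rewrite scalerDl.
Qed.
Lemma in_spanZ (V : lmodType (A k)) (s : seq V) a v :
  in_span s v -> in_span s (a *: v).
Proof.
move=> [c ->]; exists (fun i => a * c i); rewrite scaler_sumr.
by apply: eq_bigr => i _; rewrite scalerA.
Qed.
Lemma in_span0 (V : lmodType (A k)) (s : seq V) : in_span s 0.
Proof. by exists (fun=> 0); rewrite big1 // => i _; rewrite scale0r. Qed.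
Lemma in_span_sum (V : lmodType (A k)) (s : seq V) I (r : seq I) F :
  (forall i, in_span s (F i)) -> in_span s (\sum_(i <- r) F i).
Proof.
move=> h; elim: r => [|i r IH]; rewrite ?big_nil; first exact: in_span0.
by rewrite big_cons; apply: in_spanD.
Qed.
Lemma in_span_mem (V : lmodType (A k)) (s : seq V) v :
  v \in s -> in_span s v.
Proof.
move=> vs; exists (fun i => (i == index v s)%:R).
rewrite (bigD1 (Ordinal (n := size s) (m := index v s) _)) /= ?index_mem //.
move=> h; rewrite eqxx scale1r nth_index // big1 ?addr0 // => i.
by rewrite -val_eqE /= => /negPf ->; rewrite scale0r.
Qed.

End Omega.

Section OmegaFg.
Variable k : fieldType.
Implicit Types X : grmod k.

(* v (x) b - v b (x) 1 for b = x, y, xy *)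
Definition omega_gen X (b : nat) (v : X) : tens X :=
  match b with
  | 0%N => Tens (- (Ax k *: v)) v 0 0
  | 1%N => Tens (- (Ay k *: v)) 0 v 0
  | _ => Tens (- ((Ax k * Ay k) *: v)) 0 0 v
  end.
Lemma omega_genP X b (v : X) : omega_gen b v \in omega_pred (V := X).
Proof.
rewrite /omega_gen; case: b => [|[|b]]; apply/eqP;
  by rewrite /tens_mul /= !scaler0 ?addr0 addNr.
Qed.
Definition ogen X b (v : X) : omega X := Omega (omega_genP b v).

Lemma ogenD X b (u v : X) : ogen b (u + v) = ogen b u + ogen b v.
Proof.
apply: val_inj => /=; rewrite /omega_gen; case: b => [|[|b]];
  by congr Tens; rewrite ?scalerDr ?opprD //= addr0.
Qed.
Lemma ogenZ X b (c : k) (v : X) : ogen b (scal c *: v) = scal c *: ogen b v.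
Proof.
apply: val_inj => /=; rewrite /omega_gen; case: b => [|[|b]]; congr Tens => /=;
  by rewrite ?coef_scal /= ?scal0 ?scale0r ?scaler0 ?addr0 ?scalerN ?scalerA //
     mulrC.
Qed.
Lemma ogen0 X b : ogen b (0 : X) = 0.
Proof. by have /eqP := ogenD b (0 : X) 0; rewrite addr0 -subr_eq0 opprD addrA subrr sub0r oppr_eq0 => /eqP. Qed.

Lemma omega_gens X (t : omega X) :
  t = ogen 0 (t10 t) + ogen 1 (t01 t) + ogen 2 (t11 t).
Proof.
apply: val_inj => /=; have /eqP := ovalP t; case: (oval t) => a b c d.
rewrite /tens_mul /= => e.
congr Tens; rewrite /= ?addr0 ?add0r //.
by apply/eqP; rewrite -subr_eq0 !opprD !opprK !addrA e.
Qed.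

Lemma fingen_omega X : fingen X -> fingen (gomega X).
Proof.
move=> [s hs].
pose S := [seq ogen p.1 (p.2 *: v) | p <- [seq (b, m) | b <- iota 0 3,
   m <- [:: 1; Ax k; Ay k; Ax k * Ay k]], v <- s].
have hS b m i : (b < 3)%N -> m \in [:: 1; Ax k; Ay k; Ax k * Ay k] ->
   (i < size s)%N -> in_span S (ogen b (m *: s`_i)).
  move=> b3 hm hi; apply: in_span_mem.
  apply/allpairsP; exists ((b, m), s`_i); split => //; last exact: mem_nth.
  by apply/allpairsP; exists (b, m); rewrite mem_iota.
have h b v : (b < 3)%N -> in_span S (ogen b v).
  move=> b3; have [c ->] := hs v.
  have -> : ogen b (\sum_(i < size s) c i *: s`_i) =
      \sum_(i < size s) ogen b (c i *: s`_i).
    by elim/big_rec2: _ => [|i y1 y2 _ <-]; rewrite ?ogen0 ?ogenD.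
  apply: in_span_sum => i; rewrite (A_basis (c i)) !scalerDl -[scal _ in X in ogen b X]mulr1.
  rewrite -!scalerA !ogenD !ogenZ.
  by do !apply: in_spanD; apply: in_spanZ; rewrite ?scalerA; apply: hS; rewrite ?inE ?eqxx ?orbT.
exists S => t; rewrite (omega_gens t); apply: in_spanD; first apply: in_spanD;
  exact: h.
Qed.

End OmegaFg.

(* The data of a preadditive category; morphisms are compared by [heq], and
   the laws (up to [heq]) are collected in [is_preadditive]. *)
Record precat := PreCat {
  ob :> Type;
  Mor : ob -> ob -> Type;
  heq : forall X Y, Mor X Y -> Mor X Y -> Prop;
  idm : forall X, Mor X X;
  Cmp : forall X Y Z, Mor Y Z -> Mor X Y -> Mor X Z;
  zerom : forall X Y, Mor X Y;
  addm : forall X Y, Mor X Y -> Mor X Y -> Mor X Y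
}.
Arguments Mor {_} _ _.
Arguments heq {_} {X Y} _ _.
Arguments idm {_} _.
Arguments Cmp {_} {X Y Z} _ _.
Arguments zerom {_} _ _.
Arguments addm {_} {X Y} _ _.
Notation "f ≈ g" := (heq f g) (at level 70, no associativity).
Notation "g ∘ f" := (Cmp g f) (at level 40, left associativity).

Record is_preadditive (C : precat) : Prop := IsPreadditive {
  heq_refl : forall (X Y : C) (f : Mor X Y), f ≈ f;
  heq_sym : forall (X Y : C) (f g : Mor X Y), f ≈ g -> g ≈ f;
  heq_trans : forall (X Y : C) (f g h : Mor X Y), f ≈ g -> g ≈ h -> f ≈ h;
  comp_heq : forall (X Y Z : C) (g g' : Mor Y Z) (f f' : Mor X Y),
    g ≈ g' -> f ≈ f' -> g ∘ f ≈ g' ∘ f';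
  addm_heq : forall (X Y : C) (f f' g g' : Mor X Y),
    f ≈ f' -> g ≈ g' -> addm f g ≈ addm f' g';
  compA : forall (X Y Z U : C) (h : Mor Z U) (g : Mor Y Z) (f : Mor X Y),
    h ∘ (g ∘ f) ≈ h ∘ g ∘ f;
  comp1l : forall (X Y : C) (f : Mor X Y), idm Y ∘ f ≈ f;
  comp1r : forall (X Y : C) (f : Mor X Y), f ∘ idm X ≈ f;
  addmA : forall (X Y : C) (f g h : Mor X Y),
    addm f (addm g h) ≈ addm (addm f g) h;
  addmC : forall (X Y : C) (f g : Mor X Y), addm f g ≈ addm g f;
  add0m : forall (X Y : C) (f : Mor X Y), addm (zerom X Y) f ≈ f;
  addmN : forall (X Y : C) (f : Mor X Y), exists g, addm f g ≈ zerom X Y;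
  compDl : forall (X Y Z : C) (g g' : Mor Y Z) (f : Mor X Y),
    addm g g' ∘ f ≈ addm (g ∘ f) (g' ∘ f);
  compDr : forall (X Y Z : C) (g : Mor Y Z) (f f' : Mor X Y),
    g ∘ addm f f' ≈ addm (g ∘ f) (g ∘ f')
}.

Definition is_iso (C : precat) (X Y : C) (f : Mor X Y) : Prop :=
  exists g : Mor Y X, g ∘ f ≈ idm X /\ f ∘ g ≈ idm Y.

Definition isomorphic (C : precat) (X Y : C) : Prop :=
  exists f : Mor X Y, is_iso f.

Definition summ (C : precat) (X Y : C) (s : seq int) (F : int -> Mor X Y) :=
  foldr (fun n f => addm (F n) f) (zerom X Y) s.

Record prefun (C D : precat) := PreFun {
  fob :> C -> D;
  fmor : forall X Y : C, Mor X Y -> Mor (fob X) (fob Y)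
}.
Arguments fmor {C D} _ {X Y} _.

Record is_functor (C D : precat) (F : prefun C D) : Prop := IsFunctor {
  fmor_heq : forall (X Y : C) (f g : Mor X Y), f ≈ g -> fmor F f ≈ fmor F g;
  fmor_id : forall X : C, fmor F (idm X) ≈ idm (F X);
  fmor_comp : forall (X Y Z : C) (g : Mor Y Z) (f : Mor X Y),
    fmor F (g ∘ f) ≈ fmor F g ∘ fmor F f;
  fmor_add : forall (X Y : C) (f g : Mor X Y),
    fmor F (addm f g) ≈ addm (fmor F f) (fmor F g)
}.

Definition ess_image (C D : precat) (F : prefun C D) (Y : D) : Prop :=
  exists X : C, isomorphic (F X) Y.

Definition ess_surj (C D : precat) (F : prefun C D) : Prop :=
  forall Y : D, ess_image F Y.

Definition fullsub (C : precat) (P : C -> Prop) : precat :=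
  @PreCat {X : C | P X} (fun X Y => Mor (sval X) (sval Y))
    (fun _ _ f g => f ≈ g) (fun X => idm (sval X)) (fun _ _ _ g f => g ∘ f)
    (fun X Y => zerom (sval X) (sval Y)) (fun _ _ f g => addm f g).

(* C[W^-1] by generators and relations, as a preadditive category.  When the
   ordinary localization is additive (as for derived categories and Verdier
   quotients) the two agree. *)
Section Localization.
Variables (C : precat) (W : forall X Y : C, Mor X Y -> Prop).

Inductive lhom : C -> C -> Type :=
| lbase X Y (f : Mor X Y) : lhom X Y
| linv X Y (w : Mor X Y) (Ww : W w) : lhom Y X
| lcomp X Y Z (g : lhom Y Z) (f : lhom X Y) : lhom X Z
| ladd X Y (f g : lhom X Y) : lhom X Y.

Inductive leq_hom : forall X Y, lhom X Y -> lhom X Y -> Prop :=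
| leq_refl X Y (f : lhom X Y) : leq_hom f f
| leq_sym X Y (f g : lhom X Y) : leq_hom f g -> leq_hom g f
| leq_trans X Y (f g h : lhom X Y) : leq_hom f g -> leq_hom g h -> leq_hom f h
| leq_comp X Y Z (g g' : lhom Y Z) (f f' : lhom X Y) :
    leq_hom g g' -> leq_hom f f' -> leq_hom (lcomp g f) (lcomp g' f')
| leq_add X Y (f f' g g' : lhom X Y) :
    leq_hom f f' -> leq_hom g g' -> leq_hom (ladd f g) (ladd f' g')
| leq_compA X Y Z U (h : lhom Z U) (g : lhom Y Z) (f : lhom X Y) :
    leq_hom (lcomp h (lcomp g f)) (lcomp (lcomp h g) f)
| leq_comp1l X Y (f : lhom X Y) : leq_hom (lcomp (lbase (idm Y)) f) f
| leq_comp1r X Y (f : lhom X Y) : leq_hom (lcomp f (lbase (idm X))) f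
| leq_addA X Y (f g h : lhom X Y) :
    leq_hom (ladd f (ladd g h)) (ladd (ladd f g) h)
| leq_addC X Y (f g : lhom X Y) : leq_hom (ladd f g) (ladd g f)
| leq_add0 X Y (f : lhom X Y) : leq_hom (ladd (lbase (zerom X Y)) f) f
| leq_compDl X Y Z (g g' : lhom Y Z) (f : lhom X Y) :
    leq_hom (lcomp (ladd g g') f) (ladd (lcomp g f) (lcomp g' f))
| leq_compDr X Y Z (g : lhom Y Z) (f f' : lhom X Y) :
    leq_hom (lcomp g (ladd f f')) (ladd (lcomp g f) (lcomp g f'))
| leq_base X Y (f g : Mor X Y) : f ≈ g -> leq_hom (lbase f) (lbase g)
| leq_base_comp X Y Z (g : Mor Y Z) (f : Mor X Y) :
    leq_hom (lbase (g ∘ f)) (lcomp (lbase g) (lbase f))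
| leq_base_add X Y (f g : Mor X Y) :
    leq_hom (lbase (addm f g)) (ladd (lbase f) (lbase g))
| leq_invl X Y (w : Mor X Y) (Ww : W w) :
    leq_hom (lcomp (linv Ww) (lbase w)) (lbase (idm X))
| leq_invr X Y (w : Mor X Y) (Ww : W w) :
    leq_hom (lcomp (lbase w) (linv Ww)) (lbase (idm Y)).

Definition loc : precat :=
  @PreCat C lhom leq_hom (fun X => lbase (idm X)) lcomp
    (fun X Y => lbase (zerom X Y)) ladd.

Definition locf : prefun C loc := @PreFun C loc id lbase.

(* Transports the relation (Z is a cone of f) from C to C[W^-1]:
   a triangle of C[W^-1] is distinguished iff it is isomorphic to the image of
   one of C, so Z is a cone of f iff f is isomorphic to (the image of) some f0
   in C and Z to a cone of f0. *)
Definition loc_cone (cone : forall X Y : C, Mor X Y -> C -> Prop)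
    (X Y : loc) (f : Mor X Y) (Z : loc) : Prop :=
  exists (X0 Y0 Z0 : C) (f0 : Mor X0 Y0), cone X0 Y0 f0 Z0 /\
  exists (a : Mor X (locf X0)) (b : Mor Y (locf Y0)),
    [/\ is_iso a, is_iso b, fmor locf f0 ∘ a ≈ b ∘ f &
        isomorphic Z (locf Z0)].

End Localization.
Arguments lbase {C} W {X Y} f.
Arguments linv {C W X Y w} Ww.

Record fgmod (k : fieldType) := FgMod {
  fgcar :> grmod k;
  fgcarP : fingen fgcar
}.

Section GrStab.
Variable k : fieldType.
Implicit Types X Y Z : fgmod k.

Definition projective (P : fgmod k) : Prop :=
  forall X Y (e : grhom X Y) (f : grhom P Y),
    (forall y, exists x, e x = y) ->
    exists g : grhom P X, forall p, e (g p) = f p.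

Definition stab_eq X Y (f g : grhom X Y) : Prop :=
  exists P, projective P /\
  exists (u : grhom X P) (v : grhom P Y), forall x, f x - g x = v (u x).

Definition grstab : precat :=
  @PreCat (fgmod k) (fun X Y => grhom X Y) stab_eq (fun X => gid X)
    (fun _ _ _ g f => gcomp g f) (fun X Y => gzero X Y)
    (fun _ _ f g => gadd f g).

Definition one_dim (X Y : grstab) : Prop :=
  exists u : Mor X Y, ~ u ≈ zerom X Y /\
    forall f : Mor X Y, exists c : k, f ≈ gscale c u.

Definition fgshift (n : int) (X : fgmod k) : fgmod k :=
  @FgMod k (gshift n X) (fgcarP X).

Definition fgomega (X : fgmod k) : fgmod k :=
  @FgMod k (gomega X) (fingen_omega (fgcarP X)).

Definition Omega1 : prefun grstab grstab :=
  @PreFun grstab grstab (fun X => fgshift 1 (fgomega X))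
    (fun X Y f => gshift_hom 1 (gomega_hom f)).

Definition ginl (X Y : grmod k) : grhom X (gsum X Y).
Proof.
refine (@GrHom k X (gsum X Y) (fun v => (v, 0)) _ _).
  by move=> a u v; congr pair; rewrite /= scaler0 addr0.
by move=> n v; rewrite /= raddf0.
Defined.
Definition ginr (X Y : grmod k) : grhom Y (gsum X Y).
Proof.
refine (@GrHom k Y (gsum X Y) (fun v => (0, v)) _ _).
  by move=> a u v; congr pair; rewrite /= scaler0 addr0.
by move=> n v; rewrite /= raddf0.
Defined.
Definition gcopair (X Y Z : grmod k) (f : grhom X Z) (g : grhom Y Z) :
  grhom (gsum X Y) Z.
Proof.
refine (@GrHom k (gsum X Y) Z (fun v => f v.1 + g v.2) _ _).
  by move=> a u v; rewrite /= !linearP scalerDr addrACA.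
by move=> n v; rewrite raddfD /= !gfun_pr.
Defined.
Definition gpair (X Y Z : grmod k) (f : grhom X Y) (g : grhom X Z) :
  grhom X (gsum Y Z).
Proof.
refine (@GrHom k X (gsum Y Z) (fun v => (f v, g v)) _ _).
  by move=> a u v; congr pair; rewrite /= linearP.
by move=> n v; rewrite /= !gfun_pr.
Defined.

Lemma fingen_gsum (X Y : fgmod k) : fingen (gsum X Y).
Proof.
have [s hs] := fgcarP X; have [r hr] := fgcarP Y.
pose S : seq (gsum X Y) := [seq ginl X Y v | v <- s] ++ [seq ginr X Y v | v <- r].
exists S => -[v w].
have -> : (v, w) = ginl X Y v + ginr X Y w :> gsum X Y.
  by congr pair; rewrite ?addr0 ?add0r.
have [c ->] := hs v; have [d ->] := hr w.
rewrite !linear_sum; apply: in_spanD; apply: in_span_sum => i; rewrite linearZ;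
  apply/in_spanZ/in_span_mem; rewrite mem_cat map_f ?orbT //; exact: mem_nth.
Qed.

Lemma projective_gsum (P Q : fgmod k) : projective P -> projective Q ->
  projective (FgMod (fingen_gsum P Q)).
Proof.
move=> hP hQ X Y e f he.
have [g hg] := hP X Y e (gcomp f (ginl P Q)) he.
have [h hh] := hQ X Y e (gcomp f (ginr P Q)) he.
exists (gcopair g h) => -[p q]; rewrite /= raddfD /= hg hh /= -raddfD.
by congr (f _); congr pair; rewrite ?addr0 ?add0r.
Qed.

Definition gnull : grmod k.
Proof.
refine (@GrMod k 'rV[A k]_0 (fun _ v => v) _ _ _ _) => //.
- by move=> m n v; case: eqP => // _; rewrite [LHS]thinmx0 [RHS]thinmx0.
- by move=> v; exists [::] => //; rewrite [LHS]thinmx0 [RHS]thinmx0.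
Defined.

Lemma projective_gnull : exists P : fgmod k, projective P.
Proof.
have fg : fingen gnull.
  by exists [::] => v; exists (fun=> 0); rewrite [LHS]thinmx0 [RHS]thinmx0.
exists (FgMod fg) => X Y e f _; exists (gzero _ _) => p.
by rewrite [p in RHS]thinmx0 !raddf0.
Qed.

Lemma stab_eq_ext X Y (f g : grhom X Y) : f =1 g -> stab_eq f g.
Proof.
move=> e; have [P hP] := projective_gnull; exists P; split => //.
by exists (gzero _ _), (gzero _ _) => x; rewrite e subrr.
Qed.

Lemma stab_eq_sub X Y (f g f' g' : grhom X Y) :
  (forall x, f x - g x = f' x - g' x) -> stab_eq f g -> stab_eq f' g'.
Proof. by move=> e [P [hP [u [v h]]]]; exists P; split=> //; exists u, v => x; rewrite -e. Qed.

Lemma stab_eq_add X Y (f f' g g' h h' : grhom X Y) :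
  (forall x, h x - h' x = (f x - f' x) + (g x - g' x)) ->
  stab_eq f f' -> stab_eq g g' -> stab_eq h h'.
Proof.
move=> e [P [hP [u [v huv]]]] [Q [hQ [w [z hwz]]]].
exists (FgMod (fingen_gsum P Q)); split; first exact: projective_gsum.
by exists (gpair u w), (gcopair v z) => x; rewrite e huv hwz.
Qed.

Lemma grstab_preadditive : is_preadditive grstab.
Proof.
split=> /=.
- by move=> X Y f; apply: stab_eq_ext.
- move=> X Y f g [P [hP [u [v h]]]]; exists P; split=> //.
  exists u, (gcomp v (gscale (-1) (gid P))) => x /=.
  by rewrite linearZ /= -h -opprB scalN1 scaleN1r.
- move=> X Y f g h; apply: stab_eq_add => x.
  by rewrite addrA subrK.
- move=> X Y Z g g' f f' hg hf.
  have h1 : stab_eq (gcomp g f) (gcomp g f').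
    case: hf => P [hP [u [v h]]]; exists P; split => //.
    by exists u, (gcomp g v) => x; rewrite /= -raddfB h.
  have h2 : stab_eq (gcomp g f') (gcomp g' f').
    case: hg => P [hP [u [v h]]]; exists P; split => //.
    by exists (gcomp u f'), v => x; rewrite /= h.
  by apply: stab_eq_add h1 h2 => x; rewrite addrA subrK.
- move=> X Y f f' g g'; apply: stab_eq_add => x /=.
  by rewrite opprD addrACA.
- by move=> X Y Z U h g f; apply: stab_eq_ext.
- by move=> X Y f; apply: stab_eq_ext.
- by move=> X Y f; apply: stab_eq_ext.
- by move=> X Y f g h; apply: stab_eq_ext => x; rewrite /= addrA.
- by move=> X Y f g; apply: stab_eq_ext => x; rewrite /= addrC.
- by move=> X Y f; apply: stab_eq_ext => x; rewrite /= add0r.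
- move=> X Y f; exists (gscale (-1) f); apply: stab_eq_ext => x.
  by rewrite /= scalN1 scaleN1r subrr.
- by move=> X Y Z g g' f; apply: stab_eq_ext.
- by move=> X Y Z g f f'; apply: stab_eq_ext => x; rewrite /= raddfD.
Qed.

End GrStab.

Record dgmod (k : fieldType) := DgMod {
  dgcar :> grmod k;
  dif : dgcar -> dgcar;
  dif_lin : linear dif;
  dif_pr : forall n v, pr (n + 1) (dif v) = dif (pr n v);
  dif_dif : forall v, dif (dif v) = 0
}.

HB.instance Definition _ (k : fieldType) (X : dgmod k) :=
  GRing.isLinear.Build (A k) X X *:%R (@dif k X) (@dif_lin k X).

Record dghom (k : fieldType) (X Y : dgmod k) := DgHom {
  dgfun :> grhom X Y;
  dgfun_dif : forall v, dif (dgfun v) = dgfun (dif v)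
}.

Section DgModules.
Variable k : fieldType.
Implicit Types X Y Z : dgmod k.

Definition dgcat : precat.
Proof.
refine (@PreCat (dgmod k) (@dghom k) (fun _ _ f g => f =1 g)
  (fun X => @DgHom k X X (gid X) _)
  (fun X Y Z g f => @DgHom k X Z (gcomp g f) _)
  (fun X Y => @DgHom k X Y (gzero X Y) _)
  (fun X Y f g => @DgHom k X Y (gadd f g) _)).
- by [].
- by move=> v; rewrite /= !dgfun_dif.
- by move=> v; rewrite /= raddf0.
- by move=> v; rewrite /= raddfD /= !dgfun_dif.
Defined.

Lemma dgcat_preadditive : is_preadditive dgcat.
Proof.
split=> /=.
- by [].
- by move=> X Y f g h x; rewrite h.
- by move=> X Y f g h e e' x; rewrite e.
- by move=> X Y Z g g' f f' hg hf x; rewrite /= hf hg.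
- by move=> X Y f f' g g' hf hg x; rewrite /= hf hg.
- by [].
- by [].
- by [].
- by move=> X Y f g h x; rewrite /= addrA.
- by move=> X Y f g x; rewrite /= addrC.
- by move=> X Y f x; rewrite /= add0r.
- move=> X Y f.
  have h v : dif (gscale (-1) f v) = gscale (-1) f (dif v).
    by rewrite /= linearZ /= dgfun_dif.
  by exists (DgHom h) => x; rewrite /= scalN1 scaleN1r subrr.
- by [].
- by move=> X Y Z g f f' x; rewrite /= raddfD.
Qed.

Definition dg0 (X : grmod k) : dgmod k.
Proof.
refine (@DgMod k X (fun=> 0) _ _ _) => //.
  by move=> a u v; rewrite scaler0 addr0.
by move=> n v; rewrite raddf0.
Defined.

Definition dg0_hom (X Y : grmod k) (f : grhom X Y) : dghom (dg0 X) (dg0 Y).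
Proof. by refine (@DgHom k (dg0 X) (dg0 Y) f _) => v; rewrite /= raddf0. Defined.

Definition dgshift (n : int) X : dgmod k.
Proof.
refine (@DgMod k (gshift n X) (fun v => (-1) ^+ `|n|%N *: dif v) _ _ _).
- by move=> a u v; rewrite linearP scalerDr !scalerA mulrC.
- move=> i v; rewrite /= addrA -dif_pr -signr_odd.
  by case: (odd _); rewrite ?scaleN1r ?scale1r ?raddfN.
- by move=> v; rewrite linearZ /= dif_dif !scaler0.
Defined.

Definition cone X Y (f : dghom X Y) : dgmod k.
Proof.
refine (@DgMod k (gsum Y (gshift 1 X))
  (fun v => (dif v.1 + f v.2, - dif v.2)) _ _ _).
- move=> a u v; congr pair; rewrite /= !linearP ?opprD ?scalerN //.
  by rewrite scalerDr addrACA.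
- move=> n v; congr pair; rewrite /= ?raddfD /= ?raddfN /= ?addrA dif_pr //.
  by rewrite gfun_pr [n + 1]addrC.
- move=> v; rewrite /= raddfD /= dif_dif add0r dgfun_dif raddfN /= subrr.
  by congr pair; rewrite raddfN /= dif_dif !oppr0.
Defined.

(* H(f) is bijective: injectivity and surjectivity on cohomology classes *)
Definition quasi_iso X Y (f : dghom X Y) : Prop :=
  (forall x, dif x = 0 -> (exists y, f x = dif y) -> exists x', x = dif x') /\
  (forall y, dif y = 0 -> exists2 x, dif x = 0 & exists y', y - f x = dif y').

Definition A_pr (n : int) (a : A k) : A k :=
  (if n == 0 then scal (coefA 0 0 a) + scal (coefA 1 0 a) * Ax k else 0) +
  (if n == -1
   then scal (coefA 0 1 a) * Ay k + scal (coefA 1 1 a) * (Ax k * Ay k) else 0).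

Lemma coef_A_pr n a i j :
  coefA i j (A_pr n a) = if n == - j%:Z then coefA i j a else 0.
Proof.
have [h|] := boolP ((1 < i)%N || (1 < j)%N).
  by rewrite !(coefA_big _ h); case: ifP.
rewrite negb_or -!leqNgt /A_pr.
case: i j => [|[|i]] [|[|j]] // _; rewrite ?oppr0;
  case: eqP => h; case: eqP => h' //;
  by rewrite !coefAE /= ?(mulr0, mul0r, mulr1, mul1r, addr0, add0r).
Qed.

Definition greg : grmod k.
Proof.
refine (@GrMod k (A k)^o A_pr _ _ _ _).
- move=> n a b; apply: coefA_eqP;
  rewrite coef_A_pr [in RHS]coefAD [in RHS]coefAN !coef_A_pr;
  by case: eqP => _; rewrite ?subrr // coefAD coefAN.
- move=> m n a; apply: coefA_eqP; rewrite coef_A_pr;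
  by case: (m =P n) => [->|h]; rewrite ?coef_A_pr ?coefA_0; case: eqP => // e;
   case: eqP => // e'; case: h; rewrite e e'.
- move=> a; exists [:: 0; -1] => //; rewrite !big_cons big_nil addr0.
  by rewrite /A_pr /= addr0 add0r addrA; exact: A_basis.
- move=> m n a v ha.
  have ha0 i : n != 0 -> coefA i 0 a = 0.
    by move=> h; apply/eqP; apply: contraNT h => /ha ->.
  have ha1 i : n != -1 -> coefA i 1 a = 0.
    by move=> h; apply/eqP; apply: contraNT h => /ha ->.
  have z := (mulr0, mul0r, addr0, add0r).
  have if0 (b : bool) : (if b then 0 else 0) = 0 :> k by case: b.
  have ifM (b : bool) (c d : k) :
    (if b then c * d else 0) = c * (if b then d else 0) by case: b; rewrite ?mulr0.
  have hm : (m - 1 == - 1%:Z) = (m == - 0%:Z) by rewrite oppr0 subr_eq addNr.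
  have [en|n0] := eqVneq n 0.
    rewrite {n ha ha0}en in ha1 *.
    have {}ha1 i : coefA i 1 a = 0 by exact: ha1.
    apply: coefA_eqP; rewrite coef_A_pr [_ *: _]/(a * v) [_ *: _]/(a * A_pr m v);
    rewrite !coefAM !coef_A_pr ?ha1 ?z -?ifM //; by case: ifP => _; rewrite ?addr0.
  have {}ha0 i : coefA i 0 a = 0 by exact: ha0.
  have [en|n1] := eqVneq n (-1).
    rewrite {n ha ha1 n0}en.
    apply: coefA_eqP; rewrite coef_A_pr [_ *: _]/(a * v) [_ *: _]/(a * A_pr m v);
    rewrite !coefAM !coef_A_pr ?ha0 ?z ?if0 ?hm -?ifM //;
    by case: ifP => _; rewrite ?addr0.
  have {}ha1 i : coefA i 1 a = 0 by exact: ha1.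
  by apply: coefA_eqP; rewrite coef_A_pr [_ *: _]/(a * v) [_ *: _]/(a * A_pr m v);
    rewrite !coefAM !coef_A_pr ?ha0 ?ha1 ?z ?if0.
Defined.

End DgModules.

Definition simple (k : fieldType) : Type := k.
HB.instance Definition _ (k : fieldType) := GRing.Zmodule.on (simple k).

Section Simple.
Variable k : fieldType.

Definition simple_act (a : A k) (v : simple k) : simple k :=
  coefA 0 0 a * (v : k).
Fact simple_actA a b v : simple_act a (simple_act b v) = simple_act (a * b) v.
Proof. by rewrite /simple_act coefAM00 mulrA. Qed.
Fact simple_act1 : left_id 1 simple_act.
Proof. by move=> v; rewrite /simple_act coefA_1 mul1r. Qed.
Fact simple_actDr : right_distributive simple_act +%R.
Proof. by move=> a u v; rewrite /simple_act mulrDr. Qed.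
Fact simple_actDl v : {morph simple_act^~ v : a b / a + b}.
Proof. by move=> a b; rewrite /simple_act coefAD mulrDl. Qed.
HB.instance Definition _ := GRing.Zmodule_isLmodule.Build (A k) (simple k)
  simple_actA simple_act1 simple_actDr simple_actDl.

Definition gsimple : grmod k.
Proof.
refine (@GrMod k (simple k) (fun n v => if n == 0 then v else 0) _ _ _ _).
- by move=> n u v; case: eqP; rewrite ?subrr.
- by move=> m n v; case: (m =P n) => [->|h]; case: eqP => // m0;
    case: eqP => // n0; case: h; rewrite m0 n0.
- by move=> v; exists [:: 0] => //; rewrite big_seq1.
- move=> m n a v ha; rewrite ![_ *: _]/(simple_act _ _) /simple_act.
  have [->|/ha ->] := eqVneq (coefA 0 0 a) 0; first by rewrite !mul0r; case: ifP.
  by rewrite oppr0 addr0; case: ifP; rewrite ?mulr0.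
Defined.

Lemma fingen_simple : fingen gsimple.
Proof.
exists [:: 1 : simple k] => v; exists (fun=> scal (v : k)).
by rewrite big_ord1 [_ *: _]/(simple_act _ _) /simple_act coef_scal /= mulr1.
Qed.

Definition fgsimple : fgmod k := FgMod fingen_simple.

End Simple.

Section DgStab.
Variable k : fieldType.

Definition Ddg : precat := loc (C := dgcat k) (@quasi_iso k).

Definition Ddg_cone : forall X Y : Ddg, Mor X Y -> Ddg -> Prop :=
  loc_cone (fun (X Y : dgcat k) (f : Mor X Y) (Z : dgcat k) => Z = cone f).

Definition in_Db (X : Ddg) : Prop :=
  exists Y : dgmod k, fingen Y /\ @isomorphic Ddg X Y.

Definition Dbdg : precat := fullsub in_Db.

(* in a triangulated category, retracts are direct summands *)
Inductive perfect : Ddg -> Prop :=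
| perfect_A : perfect (dg0 (greg k))
| perfect_shift n (X : Ddg) : perfect X -> perfect (dgshift n X)
| perfect_cone_of (X Y Z : Ddg) (f : Mor X Y) :
    Ddg_cone f Z -> perfect X -> perfect Y -> perfect Z
| perfect_retract (X Y : Ddg) (i : Mor X Y) (r : Mor Y X) :
    r ∘ i ≈ idm X -> perfect Y -> perfect X.

Definition Wperf (X Y : Dbdg) (f : Mor X Y) : Prop :=
  exists Z : Ddg, Ddg_cone f Z /\ perfect Z.

Definition dgstab : precat := loc Wperf.

Definition dgstab_cone : forall X Y : dgstab, Mor X Y -> dgstab -> Prop :=
  loc_cone (fun (X Y : Dbdg) (f : Mor X Y) Z => Ddg_cone f (sval Z)).

Lemma in_Db_dg0 (X : fgmod k) : in_Db (dg0 X).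
Proof.
exists (dg0 X); split; first exact: fgcarP.
by exists (lbase _ (idm (dg0 X : dgcat k))), (lbase _ (idm (dg0 X : dgcat k)));
  split; apply: leq_comp1l.
Qed.

Definition dgstab0 (X : fgmod k) : dgstab := exist in_Db _ (in_Db_dg0 X).

Definition iota_hom (X Y : fgmod k) (f : grhom X Y) :
    Mor (dgstab0 X) (dgstab0 Y) :=
  lbase Wperf (X := dgstab0 X) (Y := dgstab0 Y)
    (lbase (C := dgcat k) (@quasi_iso k) (dg0_hom f)).

Definition iota : prefun (grstab k) dgstab :=
  @PreFun (grstab k) dgstab dgstab0 iota_hom.

Section Delta.
Variable X : fgmod k.

Definition omega_cone : dgmod k := cone (dg0_hom (gomega_inc X)).

Definition cone_proj_gr : grhom omega_cone X.
Proof.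
refine (@GrHom k omega_cone X (fun v => tens_mul v.1) _ _).
  by move=> a u v; rewrite linearP.
by move=> n v; apply: (gfun_pr (gtens_mul X)).
Defined.

Definition cone_proj : dghom omega_cone (dg0 X).
Proof.
refine (@DgHom k omega_cone (dg0 X) cone_proj_gr _) => -[t w].
by rewrite /= add0r; apply/esym/eqP; apply: ovalP.
Defined.

Definition cone_bd_gr : grhom omega_cone (gshift 1 (gomega X)).
Proof. by refine (@GrHom k omega_cone _ (fun v => v.2) _ _). Defined.

Definition cone_bd : dghom omega_cone (dg0 (gshift 1 (gomega X))).
Proof.
by refine (@DgHom k omega_cone (dg0 _) cone_bd_gr _) => v; rewrite /= oppr0.
Defined.

Lemma cone_proj_qis : quasi_iso cone_proj.
Proof.
split=> [[t w] e [y h]|x _].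
  exists (0, Omega (introT eqP h : t \in omega_pred (V := X))).
  have /= hw := congr1 fst e; rewrite add0r in hw.
  by congr pair; rewrite /= ?add0r ?oppr0 //; apply: val_inj.
exists (Tens x 0 0 0, 0); first by congr pair; rewrite /= ?add0r ?oppr0.
by exists 0; rewrite /= /tens_mul /= !scaler0 !addr0 subrr.
Qed.

(* The connecting morphism of 0 -> Omega X -> X (x) A -> X -> 0, as the
   fraction X <- cone(Omega X -> X (x) A) -> Omega X (1). *)
Definition delta : Mor (iota X) (iota (Omega1 k X)) :=
  lbase Wperf (X := dgstab0 X) (Y := dgstab0 (Omega1 k X))
    (lcomp (lbase (C := dgcat k) (@quasi_iso k) cone_bd)
           (linv (C := dgcat k) (W := @quasi_iso k) cone_proj_qis)).

End Delta.
End DgStab.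

Section Preadditive.
Variables (C : precat) (hC : is_preadditive C).

Lemma addm_idem (X Y : C) (f : Mor X Y) : addm f f ≈ f -> f ≈ zerom X Y.
Proof.
move=> h; have [g hg] := addmN hC f.
have e1 : addm f (addm f g) ≈ zerom X Y.
  apply: heq_trans hg => //; apply: heq_trans (addm_heq hC h (heq_refl hC g)) => //.
  exact: addmA.
apply: (heq_trans hC) e1; apply: (heq_trans hC) (addm_heq hC (heq_refl hC f) (heq_sym hC hg)).
apply: (heq_trans hC) (addmC hC _ _); apply: (heq_sym hC); exact: add0m.
Qed.

Lemma comp_zero (X Y Z : C) (g : Mor Y Z) : g ∘ zerom X Y ≈ zerom X Z.
Proof.
apply: addm_idem; apply: (heq_trans hC) (heq_sym hC (compDr hC _ _ _)) _.
by apply: comp_heq => //; [apply: heq_refl | apply: add0m].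
Qed.

Lemma zero_comp (X Y Z : C) (f : Mor X Y) : zerom Y Z ∘ f ≈ zerom X Z.
Proof.
apply: addm_idem; apply: (heq_trans hC) (heq_sym hC (compDl hC _ _ _)) _.
by apply: comp_heq => //; [apply: add0m | apply: heq_refl].
Qed.

Lemma summ_zero (X Y : C) (s : seq int) (F : int -> Mor X Y) :
  (forall n, n \in s -> F n ≈ zerom X Y) -> summ s F ≈ zerom X Y.
Proof.
elim: s => [|n s IH] h /=; first exact: heq_refl.
apply: (heq_trans hC) (add0m hC _); apply: addm_heq => //.
  by apply: h; rewrite inE eqxx.
by apply: IH => m ms; apply: h; rewrite inE ms orbT.
Qed.

End Preadditive.

Lemma fmor_zero (C D : precat) (hC : is_preadditive C) (hD : is_preadditive D)
    (F : prefun C D) (hF : is_functor F) (X Y : C) :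
  fmor F (zerom X Y) ≈ zerom (F X) (F Y).
Proof.
apply: (addm_idem hD); apply: (heq_trans hD) (heq_sym hD (fmor_add hF _ _)) _.
by apply: fmor_heq => //; apply: add0m.
Qed.

(* An action of Z, up to coherent isomorphism, by T^n, extending T^1 = T1.
   Any autoequivalence T1 extends to such an action, uniquely up to unique
   isomorphism; it amounts to replacing C by an equivalent category on which T1
   is an automorphism and taking T^n to be the n-th power. *)
Record zaction (C : precat) (T1 : prefun C C) := ZAction {
  za :> int -> prefun C C;
  za_functor : forall n, is_functor (za n);
  za_one : forall X, Mor (za 1 X) (T1 X);
  za_unit : forall X, Mor X (za 0 X);
  za_mul : forall m n p, m + n = p -> forall X, Mor (za m (za n X)) (za p X);
  za_one_iso : forall X, is_iso (za_one X);
  za_one_nat : forall X Y (f : Mor X Y),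
    za_one Y ∘ fmor (za 1) f ≈ fmor T1 f ∘ za_one X;
  za_unit_iso : forall X, is_iso (za_unit X);
  za_unit_nat : forall X Y (f : Mor X Y),
    za_unit Y ∘ f ≈ fmor (za 0) f ∘ za_unit X;
  za_mul_iso : forall m n p (e : m + n = p) X, is_iso (za_mul e X);
  za_mul_nat : forall m n p (e : m + n = p) X Y (f : Mor X Y),
    za_mul e Y ∘ fmor (za m) (fmor (za n) f) ≈ fmor (za p) f ∘ za_mul e X;
  za_assoc : forall l m n p q r (elm : l + m = p) (emn : m + n = q)
      (ep : p + n = r) (elq : l + q = r) X,
    za_mul elq X ∘ fmor (za l) (za_mul emn X) ≈ za_mul ep X ∘ za_mul elm (za n X);
  za_unitl : forall n (e : 0 + n = n) X,
    za_mul e X ∘ za_unit (za n X) ≈ idm (za n X);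
  za_unitr : forall n (e : n + 0 = n) X,
    za_mul e X ∘ fmor (za n) (za_unit X) ≈ idm (za n X)
}.

Section Orbit.
Variables (C : precat) (hC : is_preadditive C) (T1 : prefun C C).
Variable T : zaction T1.

(* an element of the direct sum of the Hom(X, T^n Y) *)
Record ohom (X Y : C) := OHom {
  ocomp :> forall n, Mor X (T n Y);
  osupp : seq int;
  osuppP : forall n, n \notin osupp -> ocomp n ≈ zerom X (T n Y)
}.

Definition oid (X : C) : ohom X X.
Proof.
refine (@OHom X X (fun n => match n with Posz 0 => za_unit T X
                                       | _ => zerom _ _ end) [:: 0] _).
by move=> [[|n]|n] //= _; apply: heq_refl.
Defined.

Definition ozero (X Y : C) : ohom X Y.
Proof.
by refine (@OHom X Y (fun n => zerom _ _) [::] _) => n _; apply: heq_refl.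
Defined.

Definition oadd (X Y : C) (f g : ohom X Y) : ohom X Y.
Proof.
refine (@OHom X Y (fun n => addm (f n) (g n)) (osupp f ++ osupp g) _).
move=> n; rewrite mem_cat negb_or => /andP[nf ng].
apply: (heq_trans hC) (add0m hC _); apply: addm_heq => //; exact: osuppP.
Defined.

(* (g f)_j = sum_i T^i(g_(j-i)) f_i *)
Definition ocompose (X Y Z : C) (g : ohom Y Z) (f : ohom X Y) : ohom X Z.
Proof.
refine (@OHom X Z (fun j => summ (undup (osupp f)) (fun i =>
    za_mul T (subrKC i j) Z ∘ fmor (T i) (g (j - i)) ∘ f i))
  [seq i + l | i <- osupp f, l <- osupp g] _).
move=> j hj; apply: summ_zero => // i; rewrite mem_undup => hi.
apply: (heq_trans hC) _ (zero_comp hC _ (f i)).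
apply: comp_heq => //; last exact: heq_refl.
apply: (heq_trans hC) _ (comp_zero hC _ _); apply: comp_heq => //.
  exact: heq_refl.
apply: (heq_trans hC) _ (fmor_zero hC hC (za_functor T i) _ _).
apply: fmor_heq; first exact: za_functor.
apply: osuppP; apply: contra hj => hl; apply/allpairsP; exists (i, j - i).
by split; rewrite // subrKC.
Defined.

Definition orbit : precat :=
  @PreCat C ohom (fun X Y f g => forall n, f n ≈ g n) oid ocompose ozero oadd.

End Orbit.

Section FA.
Variables (k : fieldType) (T : zaction (Omega1 k)).

(* the natural isomorphisms psi_n : Omega^n(n) -> id on graded modules; the
   field [psi_one] says that psi_1 is the inverse of [delta] *)
Record psi_family := PsiFamily {
  psi :> forall n (X : grstab k), Mor (iota k (T n X)) (iota k X);
  psi_iso : forall n X, is_iso (psi n X);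
  psi_nat : forall n (X Y : grstab k) (f : Mor X Y),
    psi n Y ∘ fmor (iota k) (fmor (T n) f) ≈ fmor (iota k) f ∘ psi n X;
  psi_one : forall X, delta X ∘ psi 1 X ≈ fmor (iota k) (za_one T X);
  psi_zero : forall X, psi 0 X ∘ fmor (iota k) (za_unit T X) ≈ idm (iota k X);
  psi_mul : forall m n p (e : n + m = p) X,
    psi m X ∘ psi n (T m X) ≈ psi p X ∘ fmor (iota k) (za_mul T e X)
}.

Definition CA : precat := orbit (grstab_preadditive k) T.

Definition FA (psi : psi_family) : prefun CA (dgstab k) :=
  @PreFun CA (dgstab k) (iota k) (fun X Y (f : ohom T X Y) =>
    summ (undup (osupp f)) (fun n => psi n Y ∘ fmor (iota k) (f n))).

(* [Negz n] is -(n+1): f1 sits in degree -1 and f2 in degree -2 *)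
Definition two_comp (X Y : grstab k) (f1 : Mor X (T (-1) Y))
    (f2 : Mor X (T (-2) Y)) : @Mor CA X Y.
Proof.
refine (@OHom _ _ T X Y (fun n => match n with
  | Negz 0 => f1 | Negz 1 => f2 | _ => zerom X (T _ Y) end) [:: -1; -2] _).
by move=> [n|[|[|n]]] // _; apply: (heq_refl (grstab_preadditive k)).
Defined.

End FA.

(* Main.v *)
(* For t in k put a new differential d + (-1)^n (x + t y) on a dg-module X,
   completed towards degree -oo, and let H_t(X) be its cohomology.  H_t inverts
   quasi-isomorphisms, turns cones into long exact sequences and vanishes on free
   modules, hence factors through A-dgstab.  On graded modules (d = 0) the
   vanishing of H_t does not depend on t <> 0, as one sees by rescaling the
   component of degree n by l^n.  But f_{-1} and f_{-2} act on H_t(S) = k as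
   c1 t and - c2 with c1, c2 <> 0, so H_t(K) vanishes unless t = c2 / c1.  Thus K
   is not isomorphic to a graded module.  An explicit 4-dimensional dg-module
   with the same behaviour shows that F_A is not essentially surjective. *)

From HB Require Import structures.
From mathcomp Require Import all_boot all_order all_algebra zify ring ssrAC.
From mathcomp Require Import boolp functions reals complex.
From Stdlib Require Import Setoid Morphisms.
Require Import Defs.

Set Implicit Arguments.
Unset Strict Implicit.
Unset Printing Implicit Defensive.

Import Order.TTheory GRing.Theory Num.Theory.
Local Open Scope ring_scope.

(** * Preadditive categories and localization *)

(** The self-extensions of S are generated by classes xi and eta dual to x and y. Up to scalars
    f_{-2} is xi^2 and f_{-1} is eta: they lie in different components of C(A), but become parallel
    maps S -> S(2) in A-dgstab, where they can cancel. H_t is in effect evaluation at the point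
    where eta acts as t and xi^2 as -1. The points at which a graded module has cohomology are
    stable under the torus that rescales degrees, whereas the cone of c1 eta + c2 xi^2 picks out a
    single nonzero point. Two obstacles shape the proof. A-dgstab consists of formal fractions, so
    it is studied only through functors out of it. And Omega^{-1} and the psi_n with n < 0 are known
    only through the axioms of [zaction] and [psi_family]; looping replaces maps into Omega^{-1} and
    Omega^{-2} by maps out of Omega S and Omega^2 S, after which the one morphism of A-dgstab left
    to compute is the explicit fraction [delta]. The second claim uses a concrete dg-module because
    a cone of g would first have to be constructed in the localization. *)

Section PreadditiveTheory.
Variables (E : precat) (hE : is_preadditive E).
Implicit Types X Y Z : E.

Lemma eqm_compl X Y Z (g g' : Mor Y Z) (f : Mor X Y) : g ≈ g' -> g ∘ f ≈ g' ∘ f.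
Proof. by move=> h; apply: (comp_heq hE h); apply: heq_refl. Qed.

Lemma eqm_compr X Y Z (g : Mor Y Z) (f f' : Mor X Y) : f ≈ f' -> g ∘ f ≈ g ∘ f'.
Proof. by apply: (comp_heq hE); apply: heq_refl. Qed.

Definition is_zero X : Prop := idm X ≈ zerom X X.

Lemma zero_retract X Y (i : Mor X Y) (r : Mor Y X) :
  r ∘ i ≈ idm X -> is_zero Y -> is_zero X.
Proof.
move=> ri Y0; apply: (heq_trans hE (heq_sym hE ri)).
apply: (heq_trans hE (eqm_compr r (heq_sym hE (comp1l hE i)))).
apply: (heq_trans hE _ (comp_zero hE _ r)); apply: eqm_compr.
exact: (heq_trans hE (eqm_compl i Y0) (zero_comp hE _ i)).
Qed.

Lemma zero_isomorphic X Y : isomorphic X Y -> is_zero X <-> is_zero Y.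
Proof.
by move=> [f [g [gf fg]]]; split; [apply: zero_retract fg | apply: zero_retract gf].
Qed.

Lemma zero_iso X Y (f : Mor X Y) : is_zero X -> is_zero Y -> is_iso f.
Proof.
move=> X0 Y0; exists (zerom Y X); split.
  exact: (heq_trans hE (zero_comp hE _ f) (heq_sym hE X0)).
exact: (heq_trans hE (comp_zero hE _ f) (heq_sym hE Y0)).
Qed.

Lemma iso_heq X Y (f g : Mor X Y) : f ≈ g -> is_iso f -> is_iso g.
Proof.
move=> fg [h [hf fh]]; exists h; split.
  exact: (heq_trans hE (eqm_compr h (heq_sym hE fg)) hf).
exact: (heq_trans hE (eqm_compl h (heq_sym hE fg)) fh).
Qed.

Lemma comp_isoK X Y Z (g : Mor Y Z) (g' : Mor Z Y) (f : Mor X Y) :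
  g' ∘ g ≈ idm Y -> g' ∘ (g ∘ f) ≈ f.
Proof.
move=> h; apply: (heq_trans hE (compA hE _ _ _)).
exact: (heq_trans hE (eqm_compl f h) (comp1l hE f)).
Qed.

Lemma comp_Kiso X Y Z (g : Mor Y Z) (f : Mor X Y) (f' : Mor Y X) :
  f ∘ f' ≈ idm Y -> g ∘ f ∘ f' ≈ g.
Proof.
move=> h; apply: (heq_trans hE (heq_sym hE (compA hE _ _ _))).
exact: (heq_trans hE (eqm_compr g h) (comp1r hE g)).
Qed.

Lemma iso_comp X Y Z (g : Mor Y Z) (f : Mor X Y) :
  is_iso g -> is_iso f -> is_iso (g ∘ f).
Proof.
move=> [g' [g'g gg']] [f' [f'f ff']]; exists (f' ∘ g'); split.
  apply: (heq_trans hE (heq_sym hE (compA hE _ _ _))).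
  exact: (heq_trans hE (eqm_compr f' (comp_isoK f g'g)) f'f).
apply: (heq_trans hE (compA hE _ _ _)).
exact: (heq_trans hE (eqm_compl g' (comp_Kiso g ff')) gg').
Qed.

Lemma iso_inv X Y (f : Mor X Y) (g : Mor Y X) :
  g ∘ f ≈ idm X -> f ∘ g ≈ idm Y -> is_iso g.
Proof. by move=> gf fg; exists f. Qed.

Lemma iso_square X Y X' Y' (f : Mor X Y) (f' : Mor X' Y') (a : Mor X X')
  (b : Mor Y Y') : is_iso a -> is_iso b -> f' ∘ a ≈ b ∘ f ->
  is_iso f <-> is_iso f'.
Proof.
move=> isoa isob e; have [a' [a'a aa']] := isoa; have [b' [b'b bb']] := isob.
split=> h.
  apply: (iso_heq (comp_Kiso f' aa')); apply: iso_comp (iso_inv a'a aa').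
  exact: (iso_heq (heq_sym hE e) (iso_comp isob h)).
apply: (iso_heq (comp_isoK f b'b)); apply: iso_comp (iso_inv b'b bb') _.
exact: (iso_heq e (iso_comp h isoa)).
Qed.

Lemma iso_cancelr X Y Z (g g' : Mor Y Z) (f : Mor X Y) :
  is_iso f -> g ∘ f ≈ g' ∘ f -> g ≈ g'.
Proof.
move=> [f' [_ ff']] e; apply: (heq_trans hE (heq_sym hE (comp_Kiso g ff'))).
exact: (heq_trans hE (eqm_compl f' e) (comp_Kiso g' ff')).
Qed.

Lemma iso_cancell X Y Z (g : Mor Y Z) (f f' : Mor X Y) :
  is_iso g -> g ∘ f ≈ g ∘ f' -> f ≈ f'.
Proof.
move=> [g' [g'g _]] e; apply: (heq_trans hE (heq_sym hE (comp_isoK f g'g))).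
exact: (heq_trans hE (eqm_compr g' e) (comp_isoK f' g'g)).
Qed.

End PreadditiveTheory.

Lemma functor_iso (C E : precat) (hE : is_preadditive E) (F : prefun C E)
    (hF : is_functor F) (X Y : C) (f : Mor X Y) : is_iso f -> is_iso (fmor F f).
Proof.
move=> [g [gf fg]]; exists (fmor F g); split.
  apply: (heq_trans hE (heq_sym hE (fmor_comp hF _ _))).
  exact: (heq_trans hE (fmor_heq hF gf) (fmor_id hF X)).
apply: (heq_trans hE (heq_sym hE (fmor_comp hF _ _))).
exact: (heq_trans hE (fmor_heq hF fg) (fmor_id hF Y)).
Qed.

(** * Extension of functors to a localization *)

Section LocalizationExtension.
Variables (C E : precat) (W : forall X Y : C, Mor X Y -> Prop) (F : prefun C E).
Hypotheses (hE : is_preadditive E) (hF : is_functor F).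
(** [C] is an arbitrary [precat], so compatibility with zero does not follow from additivity; the
    relation [leq_add0] calls for it. *)
Hypothesis hF0 : forall X Y : C, fmor F (zerom X Y) ≈ zerom (F X) (F Y).
Hypothesis hW : forall (X Y : C) (w : Mor X Y), W w -> is_iso (fmor F w).

(** Morphisms of [loc] are formal terms, so recursion defines the extension; whatever inverse [cid]
    picks satisfies the two relations imposed on [linv]. *)
Fixpoint lext_mor (X Y : C) (f : lhom W X Y) : Mor (F X) (F Y) :=
  match f with
  | lbase _ _ f => fmor F f
  | linv _ _ _ Ww => sval (cid (hW Ww))
  | lcomp _ _ _ g f => lext_mor g ∘ lext_mor f
  | ladd _ _ f g => addm (lext_mor f) (lext_mor g)
  end.

Lemma lext_mor_heq (X Y : C) (f g : lhom W X Y) :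
  leq_hom f g -> lext_mor f ≈ lext_mor g.
Proof.
elim=> {X Y f g} /=.
- by move=> X Y f; apply: heq_refl.
- by move=> X Y f g _; apply: (heq_sym hE).
- by move=> X Y f g h _ fg _; apply: (heq_trans hE).
- by move=> X Y Z g g' f f' _ hg _; apply: (comp_heq hE).
- by move=> X Y f f' g g' _ hf _; apply: (addm_heq hE).
- by move=> *; apply: (compA hE).
- by move=> X Y f; apply: (heq_trans hE (eqm_compl hE _ (fmor_id hF Y))); apply: (comp1l hE).
- by move=> X Y f; apply: (heq_trans hE (eqm_compr hE _ (fmor_id hF X))); apply: (comp1r hE).
- by move=> *; apply: (addmA hE).
- by move=> *; apply: (addmC hE).
- move=> X Y f; apply: (heq_trans hE _ (add0m hE _)); apply: (addm_heq hE).
    exact: hF0.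
  exact: heq_refl.
- by move=> *; apply: (compDl hE).
- by move=> *; apply: (compDr hE).
- by move=> X Y f g fg; apply: (fmor_heq hF).
- by move=> *; apply: (fmor_comp hF).
- by move=> *; apply: (fmor_add hF).
- move=> X Y w Ww; case: (cid _) => g [gw _] /=.
  exact: (heq_trans hE gw (heq_sym hE (fmor_id hF X))).
- move=> X Y w Ww; case: (cid _) => g [_ wg] /=.
  exact: (heq_trans hE wg (heq_sym hE (fmor_id hF Y))).
Qed.

Definition lext : prefun (loc W) E := @PreFun (loc W) E F lext_mor.

Lemma lext_functor : is_functor lext.
Proof.
split=> [X Y f g|X|X Y Z g f|X Y f g]; first exact: lext_mor_heq.
- exact: (fmor_id hF).
- exact: heq_refl.
- exact: heq_refl.
Qed.

End LocalizationExtension.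

(** This stands in for long exact sequences: that a cone vanishes exactly when its morphism is
    inverted is invariant under isomorphism of arrows and of cones, hence survives the passage to
    [loc_cone]. *)
Lemma loc_cone_zero (C E : precat) (W : forall X Y : C, Mor X Y -> Prop)
    (cn : forall X Y : C, Mor X Y -> C -> Prop) (hE : is_preadditive E)
    (F : prefun (loc W) E) (hF : is_functor F) :
  (forall X Y (f : Mor X Y) Z, cn X Y f Z ->
     is_zero (F Z) <-> is_iso (fmor F (lbase W f))) ->
  forall (X Y : loc W) (f : Mor X Y) Z, loc_cone cn f Z ->
    is_zero (F Z) <-> is_iso (fmor F f).
Proof.
move=> h X Y f Z [X0 [Y0 [Z0 [f0 [c0 [a [b [isoa isob e [u isou]]]]]]]]].
have isoF := functor_iso hE hF.
have eqZ : isomorphic (F Z) (F Z0) by exists (fmor F u); apply: isoF.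
rewrite (zero_isomorphic hE eqZ) (h _ _ _ _ c0).
apply: iff_sym; apply: (iso_square hE (isoF _ _ _ isoa) (isoF _ _ _ isob)).
apply: (heq_trans hE (heq_sym hE (fmor_comp hF _ _))).
exact: (heq_trans hE (fmor_heq hF e) (fmor_comp hF _ _)).
Qed.

(** * Subquotients of abelian groups *)

(* A presentation of the quotient group cyc / bnd. *)
Record sqgrp := SqGrp {
  sqcar :> zmodType;
  cyc : sqcar -> Prop;
  bnd : sqcar -> Prop;
  cyc0 : cyc 0;
  cycB : forall u v, cyc u -> cyc v -> cyc (u - v);
  bnd0 : bnd 0;
  bndB : forall u v, bnd u -> bnd v -> bnd (u - v);
  bnd_cyc : forall u, bnd u -> cyc u
}.

Section SubquotientGroups.
Variable U : sqgrp.
Implicit Types u v w : U.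

Lemma cycN u : cyc u -> cyc (- u).
Proof. by rewrite -sub0r; apply: cycB; apply: cyc0. Qed.

Lemma cycD u v : cyc u -> cyc v -> cyc (u + v).
Proof. by move=> cu /cycN; rewrite -[v in cyc (u + v)]opprK; apply: cycB. Qed.

Lemma bndN u : bnd u -> bnd (- u).
Proof. by rewrite -sub0r; apply: bndB; apply: bnd0. Qed.

Lemma bndD u v : bnd u -> bnd v -> bnd (u + v).
Proof. by move=> cu /bndN; rewrite -[v in bnd (u + v)]opprK; apply: bndB. Qed.

Lemma bnd_refl u : bnd (u - u).
Proof. by rewrite subrr; apply: bnd0. Qed.

Lemma bnd_sym u v : bnd (u - v) -> bnd (v - u).
Proof. by move/bndN; rewrite opprB. Qed.

Lemma bnd_trans v u w : bnd (u - v) -> bnd (v - w) -> bnd (u - w).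
Proof. by move=> uv vw; rewrite -[u](subrK v) -addrA; apply: bndD. Qed.

Lemma bnd_add u u' v v' : bnd (u - u') -> bnd (v - v') -> bnd (u + v - (u' + v')).
Proof. by move=> hu hv; rewrite opprD addrACA; apply: bndD. Qed.

End SubquotientGroups.

(** Maps act on representatives and are additive only modulo boundaries; this leaves room for
    inverses obtained by choosing representatives, without forming the quotient. *)
Record sqhom (U V : sqgrp) := SqHom {
  sqfun :> U -> V;
  sqfun_cyc : forall u, cyc u -> cyc (sqfun u);
  sqfun_bnd : forall u v, cyc u -> cyc v -> bnd (u - v) -> bnd (sqfun u - sqfun v);
  sqfun_add : forall u v, cyc u -> cyc v -> bnd (sqfun (u + v) - (sqfun u + sqfun v))
}.

Definition sqid U : sqhom U U.
Proof. by exists id => // u v _ _; apply: bnd_refl. Defined.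

Definition sqcomp U V W (g : sqhom V W) (f : sqhom U V) : sqhom U W.
Proof.
exists (fun u => g (f u)).
- by move=> u cu; do 2!apply: sqfun_cyc.
- move=> u v cu cv uv; have [fu fv] := (sqfun_cyc f cu, sqfun_cyc f cv).
  exact: (sqfun_bnd g fu fv (sqfun_bnd f cu cv uv)).
- move=> u v cu cv; have [fu fv] := (sqfun_cyc f cu, sqfun_cyc f cv).
  apply: bnd_trans (sqfun_add g fu fv); apply: sqfun_bnd; last exact: sqfun_add.
    by apply: sqfun_cyc; apply: cycD.
  exact: cycD.
Defined.

Definition sqzero U V : sqhom U V.
Proof.
exists (fun=> 0) => *; first exact: cyc0; first exact: bnd_refl.
by rewrite addr0; apply: bnd_refl.
Defined.

Definition sqadd U V (f g : sqhom U V) : sqhom U V.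
Proof.
exists (fun u => f u + g u).
- by move=> u cu; apply: cycD; apply: sqfun_cyc.
- by move=> u v cu cv uv; apply: bnd_add; apply: sqfun_bnd.
- by move=> u v cu cv; rewrite addrACA; apply: bnd_add; apply: sqfun_add.
Defined.

Definition sqcat : precat :=
  @PreCat sqgrp sqhom (fun U V f g => forall u, cyc u -> bnd (f u - g u))
    sqid sqcomp sqzero sqadd.

Lemma sqfun0 U V (f : sqhom U V) : bnd (f 0).
Proof.
have := sqfun_add f (cyc0 U) (cyc0 U).
by rewrite addr0 opprD addrA subrr sub0r => /bndN; rewrite opprK.
Qed.

Lemma sqfunN U V (f : sqhom U V) u : cyc u -> bnd (f (- u) + f u).
Proof.
move=> cu; have := sqfun_add f (cycN cu) cu; rewrite addNr => /bnd_sym h.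
by have := bndD h (sqfun0 f); rewrite subrK.
Qed.

Lemma sqcat_preadditive : is_preadditive sqcat.
Proof.
split=> /=.
- by move=> U V f u _; apply: bnd_refl.
- by move=> U V f g h u /h; apply: bnd_sym.
- by move=> U V f g h fg gh u cu; apply: bnd_trans (fg u cu) (gh u cu).
- move=> U V W g g' f f' hg hf u cu /=; have [fu f'u] := (sqfun_cyc f cu, sqfun_cyc f' cu).
  exact: bnd_trans (sqfun_bnd g fu f'u (hf u cu)) (hg _ f'u).
- by move=> U V f f' g g' hf hg u cu; apply: bnd_add; [apply: hf | apply: hg].
- by move=> *; apply: bnd_refl.
- by move=> *; apply: bnd_refl.
- by move=> *; apply: bnd_refl.
- by move=> U V f g h u _ /=; rewrite addrA; apply: bnd_refl.
- by move=> U V f g u _ /=; rewrite [f u + _]addrC; apply: bnd_refl.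
- by move=> U V f u _ /=; rewrite add0r; apply: bnd_refl.
- move=> U V f; have h0 u : cyc u -> cyc (- f u) by move=> /(sqfun_cyc f)/cycN.
  have h1 u v : cyc u -> cyc v -> bnd (u - v) -> bnd (- f u - - f v).
    by move=> cu cv uv; rewrite -opprD; apply/bndN/sqfun_bnd.
  have h2 u v : cyc u -> cyc v -> bnd (- f (u + v) - (- f u - f v)).
    by move=> cu cv; rewrite -!opprD; apply/bndN/sqfun_add.
  by exists (SqHom h0 h1 h2) => u cu /=; rewrite subrr subr0; apply: bnd0.
- by move=> *; apply: bnd_refl.
- by move=> U V W g f f' u cu; apply: sqfun_add; apply: sqfun_cyc.
Qed.

Lemma sq_zeroP (U : sqcat) : is_zero U <-> (forall u : U, cyc u -> bnd u).
Proof. by split=> h u /h; rewrite /= subr0. Qed.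

Lemma sq_isoP (U V : sqcat) (f : Mor U V) :
  is_iso f <-> (forall u : U, cyc u -> bnd (f u) -> bnd u) /\
               (forall v : V, cyc v -> exists2 u, cyc u & bnd (v - f u)).
Proof.
split=> [[g [gf fg]]|[inj surj]].
  split=> [u cu fu|v cv]; last first.
    by exists (g v); [apply: sqfun_cyc | apply/bnd_sym/fg].
  have := gf u cu; rewrite /= => /bnd_sym h; rewrite -[u](subrK (g (f u))).
  apply: bndD => //; have := sqfun_bnd g (bnd_cyc fu) (cyc0 V).
  by rewrite subr0 => /(_ fu) h'; have := bndD h' (sqfun0 g); rewrite subrK.
have injB u v : cyc u -> cyc v -> bnd (f u - f v) -> bnd (u - v).
  move=> cu cv fuv; apply: inj; first exact: cycB.
  have h : bnd (f (u - v) - (f u - f v)).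
    apply: bnd_trans (sqfun_add f cu (cycN cv)) _; apply: bnd_add; first exact: bnd_refl.
    by rewrite opprK; apply: sqfunN.
  by rewrite -[f _](subrK (f u - f v)); apply: bndD.
(* A preimage is chosen for each cycle, with the dummy value 0 elsewhere; injectivity then makes the
   choice additive up to boundaries. *)
have [g hg] : {g : V -> U & forall v, cyc v -> cyc (g v) /\ bnd (v - f (g v))}.
  apply: (@choice V U (fun v u => cyc v -> cyc u /\ bnd (v - f u))) => v.
  have [cv|ncv] := pselect (cyc v); last by exists 0.
  by have [u cu fu] := surj v cv; exists u.
have gC v : cyc v -> cyc (g v) by move=> /hg[].
have gF v : cyc v -> bnd (f (g v) - v) by move=> /hg[_ /bnd_sym].
have gB u v : cyc u -> cyc v -> bnd (u - v) -> bnd (g u - g v).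
  move=> cu cv uv; apply: injB; [exact: gC | exact: gC |].
  by apply: bnd_trans (gF u cu) _; apply: bnd_trans uv (bnd_sym (gF v cv)).
have gA u v : cyc u -> cyc v -> bnd (g (u + v) - (g u + g v)).
  move=> cu cv; have cuv := cycD cu cv.
  apply: injB; [exact: gC | by apply: cycD; apply: gC |].
  apply: bnd_trans (gF _ cuv) _; apply: bnd_sym.
  apply: bnd_trans (sqfun_add f (gC u cu) (gC v cv)) _.
  by apply: bnd_add; apply: gF.
exists (SqHom gC gB gA); split=> u cu /=; last exact: gF.
have fu := sqfun_cyc f cu; apply: injB; [exact: gC | by [] | exact: gF].
Qed.

(** * The specialization functors *)

Section Specialization.
Variables (k : fieldType) (t : k).
Local Notation x := (Ax k).
Local Notation ty := (scal t * Ay k).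

Definition sgA (n : int) : A k := (-1) ^+ `|n|%N.

Lemma sgAS n : sgA (n + 1) = - sgA n.
Proof.
rewrite /sgA; case: n => [n|[|n]]; first by rewrite -PoszD addn1 /= exprS mulN1r.
  by rewrite /= expr0 expr1 opprK.
have -> : Negz n.+1 + 1 = Negz n by rewrite !NegzE; lia.
by rewrite /= [in RHS]exprS mulN1r opprK.
Qed.

Lemma sgAP n : sgA (n - 1) = - sgA n.
Proof. by rewrite -[in RHS](subrK 1 n) sgAS opprK. Qed.

Lemma sgA_sq n : sgA n * sgA n = 1.
Proof. by rewrite -expr2 sqrr_sign. Qed.

Lemma pr_sgA (X : grmod k) m n (v : X) : pr n (sgA m *: v) = sgA m *: pr n v.
Proof.
by rewrite /sgA -signr_odd; case: odd; rewrite ?scaleN1r ?scale1r ?raddfN.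
Qed.

Lemma ty2 : ty * ty = 0 :> A k.
Proof. by rewrite mulrACA Ay2 mulr0. Qed.

Lemma pr_ty (X : grmod k) n (v : X) : pr n (ty *: v) = ty *: pr (n + 1) v.
Proof. by rewrite -!scalerA pr_scal pr_y. Qed.

Definition zact (X : grmod k) (v : int -> X) (n : int) : X :=
  x *: v n + ty *: v (n + 1).

Definition tdif (X : dgmod k) (v : int -> X) (n : int) : X :=
  dif (v (n - 1)) + sgA n *: zact v n.

(* The cochains form the completion of X towards degree -oo: a differential of
   degree 1 perturbed by terms of degree at most 0 then still has no cohomology
   when X is acyclic. *)
Definition cochain (X : grmod k) (v : int -> X) : Prop :=
  (forall n, pr n (v n) = v n) /\ exists N : int, forall n : int, N < n -> v n = 0.

Definition tcyc (X : dgmod k) (v : int -> X) : Prop :=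
  cochain v /\ forall n, tdif v n = 0.

Definition tbnd (X : dgmod k) (v : int -> X) : Prop :=
  exists w, cochain w /\ forall n, v n = tdif w n.

Lemma cochain0 (X : grmod k) : cochain (fun=> 0 : X).
Proof. by split=> [n|]; [rewrite raddf0 | exists 0]. Qed.

Lemma cochainB (X : grmod k) (u v : int -> X) :
  cochain u -> cochain v -> cochain (fun n => u n - v n).
Proof.
move=> [hu [N bu]] [hv [M bv]]; split=> [n|]; first by rewrite raddfB /= hu hv.
by exists (Num.max N M) => n; rewrite gt_max => /andP[/bu -> /bv ->]; rewrite subrr.
Qed.

Lemma cochainN (X : grmod k) (u : int -> X) : cochain u -> cochain (fun n => - u n).
Proof.
move=> [hu [N bu]]; split=> [n|]; first by rewrite raddfN /= hu.
by exists N => n /bu ->; rewrite oppr0.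
Qed.

Lemma cochainD (X : grmod k) (u v : int -> X) :
  cochain u -> cochain v -> cochain (fun n => u n + v n).
Proof.
move=> cu /cochainN cv; have := cochainB cu cv.
by congr cochain; apply: funext => n; rewrite opprK.
Qed.

Lemma cochain_map (X Y : grmod k) (f : grhom X Y) (v : int -> X) :
  cochain v -> cochain (fun n => f (v n)).
Proof.
move=> [hv [N bv]]; split=> [n|]; first by rewrite gfun_pr hv.
by exists N => n /bv ->; rewrite raddf0.
Qed.

Lemma zactB (X : grmod k) (u v : int -> X) n :
  zact (fun n => u n - v n) n = zact u n - zact v n.
Proof. by rewrite /zact !scalerBr opprD addrACA. Qed.

Lemma tdifB (X : dgmod k) (u v : int -> X) n :
  tdif (fun n => u n - v n) n = tdif u n - tdif v n.
Proof. by rewrite /tdif zactB raddfB scalerBr opprD addrACA. Qed.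

Lemma zact0 (X : grmod k) n : zact (fun=> 0 : X) n = 0.
Proof. by rewrite /zact !scaler0 addr0. Qed.

Lemma tdif0 (X : dgmod k) n : tdif (fun=> 0 : X) n = 0.
Proof. by rewrite /tdif zact0 raddf0 scaler0 addr0. Qed.

Lemma tdifN (X : dgmod k) (u : int -> X) n : tdif (fun n => - u n) n = - tdif u n.
Proof.
rewrite -[RHS]sub0r -(tdif0 X n) -tdifB; congr tdif.
by apply: funext => m; rewrite sub0r.
Qed.

Lemma tdifD (X : dgmod k) (u v : int -> X) n :
  tdif (fun n => u n + v n) n = tdif u n + tdif v n.
Proof.
rewrite -[tdif v n]opprK -tdifN -tdifB; congr tdif.
by apply: funext => m; rewrite opprK.
Qed.

Lemma zact_map (X Y : grmod k) (f : grhom X Y) (v : int -> X) n :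
  zact (fun n => f (v n)) n = f (zact v n).
Proof. by rewrite /zact raddfD /= !linearZ. Qed.

Lemma tdif_map (X Y : dgmod k) (f : dghom X Y) (v : int -> X) n :
  tdif (fun n => f (v n)) n = f (tdif v n).
Proof. by rewrite /tdif zact_map dgfun_dif [RHS]raddfD /= linearZ. Qed.

(** The sign is essential, as (x + t y)^2 = 2 t x y: since y changes the parity of the degree, the
    two mixed terms get opposite signs and cancel. The same sign makes the action anticommute with
    [dif]. *)
Lemma zact_zact (X : grmod k) (v : int -> X) n :
  zact (fun n => sgA n *: zact v n) n = 0.
Proof.
have e (a b s : A k) : a * s * b = s * (a * b) by rewrite [a * s]mulrC mulrA.
rewrite /zact sgAS; move: ty ty2 (Ax2 k) (sgA n) => b b2 a2 s.
rewrite !scalerDr !scalerA !e a2 b2 !mulr0 !scale0r add0r addr0.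
by rewrite -scalerDl [x * _]mulrC mulNr subrr scale0r.
Qed.

Lemma zact_dif (X : dgmod k) (v : int -> X) n :
  zact (fun n => dif (v (n - 1))) n = dif (zact v (n - 1)).
Proof. by rewrite /zact raddfD /= !linearZ addrAC. Qed.

Lemma zactD (X : grmod k) (u v : int -> X) n :
  zact (fun n => u n + v n) n = zact u n + zact v n.
Proof. by rewrite /zact !scalerDr addrACA. Qed.

Lemma tdif_tdif (X : dgmod k) (v : int -> X) n : tdif (tdif v) n = 0.
Proof.
rewrite /tdif zactD zact_zact addr0 zact_dif [dif (_ + _)]raddfD /= dif_dif add0r.
by rewrite [dif _ in LHS]linearZ /= sgAP scaleNr addNr.
Qed.

Lemma cochain_tdif (X : dgmod k) (v : int -> X) : cochain v -> cochain (tdif v).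
Proof.
move=> [hv [N bv]]; split=> [n|]; last first.
  exists (N + 1) => n hn; rewrite /tdif /zact !bv ?raddf0 ?scaler0 ?addr0 ?scaler0 ?addr0 //; lia.
rewrite /tdif raddfD /= -[X in pr X (dif _)](subrK 1 n) dif_pr hv; congr (_ + _).
by rewrite pr_sgA /zact raddfD /= pr_x pr_ty !hv.
Qed.

Lemma tbnd_cyc (X : dgmod k) (u : int -> X) : tbnd u -> tcyc u.
Proof.
move=> [w [cw e]]; have -> : u = tdif w by apply: funext.
by split; [apply: cochain_tdif | apply: tdif_tdif].
Qed.

Definition spec_ob (X : dgmod k) : sqgrp.
Proof.
refine (@SqGrp (int -> X) (@tcyc X) (@tbnd X) _ _ _ _ (@tbnd_cyc X)).
- by split; [apply: cochain0 | apply: tdif0].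
- move=> u v [cu du] [cv dv]; split; first exact: cochainB.
  by move=> n; rewrite [LHS]tdifB du dv subrr.
- by exists (fun=> 0); split; [apply: cochain0 | move=> n; rewrite tdif0].
- move=> u v [w [cw e]] [w' [cw' e']]; exists (fun n => w n - w' n).
  by split; [apply: cochainB | move=> n; rewrite tdifB -e -e'].
Defined.

Lemma tbnd0 (X : dgmod k) (u : int -> X) : (forall n, u n = 0) -> tbnd u.
Proof. by move=> h; exists (fun=> 0); split=> [|n]; [apply: cochain0 | rewrite tdif0]. Qed.

Definition spec_mor (X Y : dgmod k) (f : dghom X Y) : sqhom (spec_ob X) (spec_ob Y).
Proof.
refine (@SqHom (spec_ob X) (spec_ob Y) (fun v n => f (v n)) _ _ _).
- move=> v [cv dv]; split; first exact: cochain_map.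
  by move=> n; rewrite tdif_map dv raddf0.
- move=> u v _ _ [w [cw e]]; exists (fun n => f (w n)); split; first exact: cochain_map.
  by move=> n; rewrite tdif_map -e !fctE raddfB.
- by move=> u v _ _; apply: tbnd0 => n; rewrite !fctE raddfD subrr.
Defined.

Definition spec : prefun (dgcat k) sqcat := @PreFun (dgcat k) sqcat spec_ob spec_mor.

Lemma spec_functor : is_functor spec.
Proof.
split=> /=.
- by move=> X Y f g fg u _; apply: tbnd0 => n; rewrite !fctE fg subrr.
- by move=> X u _; apply: tbnd0 => n; rewrite !fctE subrr.
- by move=> X Y Z g f u _; apply: tbnd0 => n; rewrite !fctE subrr.
- by move=> X Y f g u _; apply: tbnd0 => n; rewrite !fctE subrr.
Qed.

Lemma spec_zeroP (X : dgmod k) :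
  is_zero (spec X) <-> (forall v : int -> X, tcyc v -> tbnd v).
Proof. exact: sq_zeroP. Qed.

End Specialization.

(** * Acyclic modules, cones and shifts *)

Section SpecializationExact.
Variables (k : fieldType) (t : k).
Local Notation x := (Ax k).
Local Notation ty := (scal t * Ay k).
Local Notation zact := (zact t).
Local Notation tdif := (tdif t).
Local Notation tcyc := (tcyc t).
Local Notation tbnd := (tbnd t).
Local Notation spec := (spec t).

Lemma zact_ext (X : grmod k) (u v : int -> X) n :
  u n = v n -> u (n + 1) = v (n + 1) -> zact u n = zact v n.
Proof. by rewrite /zact => -> ->. Qed.

Lemma tdifZ (X : dgmod k) (a : A k) (v : int -> X) n :
  tdif (fun n => a *: v n) n = a *: tdif v n.
Proof.
rewrite /tdif /zact linearZ /= !scalerDr !scalerA.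
by rewrite -!mulrA ![a * _]mulrC -!mulrA ![_ * a]mulrC !mulrA.
Qed.

Section Acyclic.
Variables (X : dgmod k) (v : int -> X) (N : int) (I : X -> X).
Hypotheses (hv : forall n, pr n (v n) = v n) (bv : forall n : int, N < n -> v n = 0).
Hypothesis cv : forall n, tdif v n = 0.
Hypothesis hI : forall r, dif r = 0 -> dif (I r) = r.

(* The pair (w_(N-m), w_(N-m+1)) of a primitive w of v, solved downwards from
   w_n = 0 for n >= N. *)
Fixpoint primitive_pair (m : nat) : X * X :=
  if m isn't m'.+1 then (0, 0) else
  let: (a, b) := primitive_pair m' in
  (pr (N - m%:Z) (I (v (N - m'%:Z) - sgA k (N - m'%:Z) *: (x *: a + ty *: b))), a).

Definition primitive (n : int) : X :=
  if N - n is Posz m then (primitive_pair m).1 else 0.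

Lemma primitive_above (n : int) : N <= n -> primitive n = 0.
Proof.
rewrite /primitive => h; case e: (N - n) => [m|//].
by have -> : m = 0%N by lia.
Qed.

Lemma primitive_pairE m :
  primitive_pair m = (primitive (N - m%:Z), primitive (N - m%:Z + 1)).
Proof.
have e n : primitive (N - n%:Z) = (primitive_pair n).1.
  by rewrite /primitive opprB addrC subrK.
case: m => [|m]; first by rewrite !primitive_above //; lia.
have -> : N - m.+1%:Z + 1 = N - m%:Z by lia.
by rewrite !e /=; case: (primitive_pair m).
Qed.

Lemma primitive_below (n : int) : n <= N -> primitive (n - 1) =
  pr (n - 1) (I (v n - sgA k n *: zact primitive n)).
Proof.
move=> h; have [m em] : exists m : nat, n = N - m%:Z by exists `|N - n|%N; lia.
have -> : primitive (n - 1) = (primitive_pair m.+1).1.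
  by rewrite primitive_pairE /=; congr primitive; lia.
rewrite /= primitive_pairE /= -em.
by have -> : N - m.+1%:Z = n - 1 by lia.
Qed.

Lemma cochain_primitive : cochain primitive.
Proof.
split=> [n|]; last by exists N => n h; apply: primitive_above; apply: ltW.
have [h|h] := leP N n; first by rewrite primitive_above ?raddf0.
rewrite -[n](addrK 1) primitive_below; last by lia.
by rewrite prK eqxx.
Qed.

Lemma primitive_top (n : int) : N < n -> tdif primitive n = v n.
Proof.
move=> h; have z (m : int) : N <= m -> dif (primitive m) = 0.
  by move=> hm; rewrite primitive_above ?raddf0.
by rewrite bv // /tdif /zact z ?primitive_above ?scaler0 ?add0r ?addr0 ?scaler0 //; lia.
Qed.

(** Comparing the cocycle condition on [v] with [tdif (tdif primitive) = 0] at n + 1 shows that the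
    remaining error at n is a [dif]-cycle, so [I] applies to it. The perturbation at n + 1 reads the
    components n + 1 and n + 2, hence the two hypotheses. *)
Lemma primitive_step (n : int) : tdif primitive (n + 1) = v (n + 1) ->
  tdif primitive (n + 1 + 1) = v (n + 1 + 1) -> tdif primitive n = v n.
Proof.
move=> h1 h2; have [/primitive_top//|h] := ltP N n.
set r := v n - sgA k n *: zact primitive n.
have dr : dif r = 0.
  have := cv (n + 1); rewrite /tdif addrK (zact_ext (esym h1) (esym h2)).
  have := tdif_tdif t primitive (n + 1); rewrite {1}/tdif addrK => {1}<- /addIr.
  by rewrite {1}/tdif [in RHS]raddfD /= dif_dif add0r raddfB /= => ->; rewrite subrr.
rewrite /tdif primitive_below // -/r -dif_pr subrK hI //.
have hw := (fst cochain_primitive); rewrite /r raddfB /= hv pr_sgA.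
by rewrite [pr n (zact _ _)]raddfD /= pr_x pr_ty !hw subrK.
Qed.

Lemma primitiveP n : tdif primitive n = v n.
Proof.
have [m] : exists m : nat, N - n < m%:Z by exists (`|N - n|.+1)%N; lia.
elim: m n => [|m IH] n hm.
  by apply: primitive_top; lia.
by apply: primitive_step; apply: IH; lia.
Qed.
End Acyclic.

Lemma acyclic_zero (X : dgmod k) :
  (forall r : X, dif r = 0 -> exists u, r = dif u) -> is_zero (spec X).
Proof.
move=> acX; apply/spec_zeroP => v [[hv [N bv]] cv].
have [I hI] : {I : X -> X & forall r, dif r = 0 -> dif (I r) = r}.
  apply: (@choice X X (fun r u => dif r = 0 -> dif u = r)) => r.
  by have [/acX[u ->]|] := pselect (dif r = 0); [exists u | exists 0].
exists (primitive v N I); split; first exact: cochain_primitive.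
by move=> n; rewrite primitiveP.
Qed.

(** Degree i - 1 of the summand X(1) is degree i of X. This shift of parity gives the perturbation
    the same minus sign as the differential of X(1), so the perturbed complex of a cone is the cone
    of the perturbed complexes. *)
Lemma cone_tdif (X Y : dgmod k) (f : dghom X Y) (c : int -> cone f) n :
  tdif c n = (tdif (fun i => (c i).1) n + f (c (n - 1)).2,
              - tdif (fun i => (c (i - 1)).2 : X) (n + 1)).
Proof.
congr pair; rewrite /= ?addrK /tdif /zact /=; first by rewrite addrAC.
by rewrite !addrK opprD sgAS scaleNr opprK.
Qed.

Lemma cochain_cone (X Y : dgmod k) (f : dghom X Y) (c : int -> cone f) :
  cochain c <-> cochain (fun i => (c i).1) /\ cochain (fun i => (c (i - 1)).2 : X).
Proof.
split=> [[hc [N bc]]|[[hy [N by_]] [hx [M bx]]]].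
  split; split.
  - by move=> n; have /= := congr1 fst (hc n).
  - by exists N => n /bc ->.
  - by move=> n; have /= := congr1 snd (hc (n - 1)); rewrite addrC subrK.
  - by exists (N + 1) => n hn; rewrite bc //; lia.
split=> [n|].
  have := hx (n + 1); rewrite /= addrK => e1; have /= e2 := hy n.
  by rewrite /= e2 addrC e1; case: (c n).
exists (Num.max N M) => n; rewrite gt_max => /andP[/by_ e1 hM].
have := bx (n + 1); rewrite /= addrK => /(_ _) e2.
by rewrite [c n]surjective_pairing e1 e2 //; lia.
Qed.

Lemma cone_zeroP (X Y : dgmod k) (f : dghom X Y) :
  is_zero (spec (cone f)) <-> is_iso (fmor spec (X := X) (Y := Y) f).
Proof.
rewrite spec_zeroP sq_isoP; split=> [h|[inj surj] c [cc dc]].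
  split=> [a [ca da] [y [cy ey]]|y [cy dy]].
    (* If f(a) bounds y, then (-y, a) is a cocycle of the cone, and the second component of a
       primitive bounds a up to sign. *)
    have [] := h (fun n => (- y n, a (n + 1))).
      split.
        apply/cochain_cone; split; first exact: cochainN.
        by rewrite (_ : (fun i => _) = a) //; apply: funext => i; rewrite /= subrK.
      move=> n; rewrite cone_tdif /= subrK tdifN -ey.
      rewrite [X in (X, _)]addNr; congr pair.
      have -> : (fun i => a (i - 1 + 1)) = a by apply: funext => i; rewrite subrK.
      by rewrite da oppr0.
    move=> c [/cochain_cone[_ cc] e].
    exists (fun n => - (c (n - 1)).2 : X); split; first exact: cochainN.
    move=> n; rewrite tdifN; have := congr1 snd (e (n - 1)).
    by rewrite cone_tdif /= subrK.
  (* A primitive of (y, 0) consists of a cocycle of X and a cochain showing that its image is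
     cohomologous to y. *)
  have [] := h (fun n => (y n, 0)).
    split; first by apply/cochain_cone; split=> //; apply: cochain0.
    by move=> n; rewrite cone_tdif /= dy add0r raddf0 tdif0 oppr0.
  move=> c [/cochain_cone[cy2 cx2] e].
  exists (fun n => (c (n - 1)).2 : X).
    split=> // n; have := congr1 snd (e (n - 1)).
    by rewrite cone_tdif /= subrK => /esym/eqP; rewrite oppr_eq0 => /eqP.
  exists (fun n => (c n).1); split=> // n; have := congr1 fst (e n).
  by rewrite cone_tdif !fctE /= => ->; rewrite addrK.
have [cy cx] := (cochain_cone c).1 cc.
set y := fun n => (c n).1 in cy *; set a := (fun n => (c (n - 1)).2 : X) in cx *.
have dy n : tdif y n = - f (a n).
  by apply/eqP; rewrite -addr_eq0; have := congr1 fst (dc n); rewrite cone_tdif /= => ->.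
have da n : tdif a n = 0.
  have := congr1 snd (dc (n - 1)); rewrite cone_tdif /= subrK => /eqP.
  by rewrite oppr_eq0 => /eqP.
(* Injectivity bounds the X-component by u; then y + f(u) is a cocycle, and surjectivity writes it
   as f(b) plus the coboundary of w. The primitive is (w, b - u). *)
have [u [cu eu]] : tbnd a.
  apply: inj; first by split.
  exists (fun n => - y n); split; first exact: cochainN.
  by move=> n; rewrite tdifN dy opprK.
have [b [cb db] [w [cw ew]]] : exists2 b, tcyc b & tbnd (fun n => y n + f (u n) - f (b n)).
  apply: (surj (fun n => y n + f (u n))); split.
    by apply: cochainD => //; apply: cochain_map.
  by move=> n; rewrite tdifD tdif_map dy eu addNr.
exists (fun n => (w n, b (n + 1) - u (n + 1))); split.
  apply/cochain_cone; split=> //.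
  by have := cochainB cb cu; congr cochain; apply: funext => i; rewrite /= subrK.
move=> n; rewrite cone_tdif /= subrK -ew.
have -> : (fun i => b (i - 1 + 1) - u (i - 1 + 1)) = (fun i => b i - u i).
  by apply: funext => i; rewrite subrK.
rewrite tdifB db sub0r opprK -eu /a addrK raddfB /= addrA subrK addrK.
exact: surjective_pairing.
Qed.

Lemma quasi_iso_acyclic (X Y : dgmod k) (f : dghom X Y) : quasi_iso f ->
  forall r : cone f, dif r = 0 -> exists u, r = dif u.
Proof.
move=> [inj surj] [y a] [/= e1 /eqP]; rewrite oppr_eq0 => /eqP e2.
have [|a1 ea1] := inj a e2.
  by exists (- y); apply/eqP; rewrite raddfN -addr_eq0 addrC e1.
have [|a2 da2 [y' ey']] := surj (y + f a1).
  by rewrite raddfD /= dgfun_dif -ea1.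
exists (y', a2 - a1); rewrite /= [dif (a2 - a1)]raddfB /= da2 sub0r opprK -ea1.
by rewrite -ey' raddfB /= addrA subrK addrK.
Qed.

(** Passing to the cone reduces the inversion of quasi-isomorphisms to the vanishing on acyclic
    modules. *)
Lemma spec_quasi_iso (X Y : dgcat k) (f : Mor X Y) :
  quasi_iso f -> is_iso (fmor spec f).
Proof. by move=> qf; apply/cone_zeroP/acyclic_zero/quasi_iso_acyclic. Qed.

Lemma sgAD m n : sgA k (m + n) = sgA k m * sgA k n.
Proof.
elim/int_rect: m => [|m IH|m IH]; first by rewrite add0r /sgA expr0 mul1r.
  by rewrite -addn1 PoszD addrAC !sgAS IH mulNr.
by rewrite -addn1 PoszD opprD addrAC !sgAP IH mulNr.
Qed.

Lemma spec_shift_zero (n : int) (X : dgmod k) :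
  is_zero (spec X) -> is_zero (spec (dgshift n X)).
Proof.
rewrite !spec_zeroP => h v [[hv [N bv]] dv].
(* Both terms acquire the factor (-1)^n: the differential by definition of the shift, the
   perturbation because its sign is taken at i instead of n + i. *)
have e (w : int -> X) i :
    tdif (fun j => w (n + j) : dgshift n X) i = sgA k n *: tdif w (n + i).
  rewrite /tdif /zact [RHS]scalerDr [in RHS]scalerA sgAD mulrA sgA_sq mul1r.
  by rewrite /= !addrA.
pose u j : X := v (j - n).
have uv : (fun j => u (n + j)) = v by apply: funext => j; rewrite /u addrAC subrr add0r.
have cu : tcyc u.
  split; first split=> [j|].
  - by have := hv (j - n); rewrite /= [n + _]addrC subrK.
  - by exists (N + n) => j hj; apply: bv; lia.
  move=> j; have := dv (j - n); rewrite -uv e => /(congr1 (fun w => sgA k n *: w)).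
  by rewrite scalerA sgA_sq scale1r [n + _]addrC subrK scaler0.
have [w [[hw [M bw]] ew]] := h u cu.
exists (fun j => sgA k n *: w (n + j)); split; first split=> [j|].
- by rewrite [pr _ _](pr_sgA n (n + j)) hw.
- by exists (M - n) => j hj; rewrite bw ?scaler0 //; lia.
move=> j; rewrite (e (fun j => sgA k n *: w j)) -uv /= ew.
by rewrite tdifZ scalerA sgA_sq scale1r.
Qed.

End SpecializationExact.

(** * Vanishing on free and projective modules *)

Section TensorAction.
Variables (k : fieldType) (V : lmodType (A k)).
Implicit Types a b c e : V.

Lemma tens_scal (s : k) a b c e :
  scal s *: Tens a b c e = Tens (scal s *: a) (scal s *: b) (scal s *: c) (scal s *: e).
Proof.
by congr Tens; rewrite /= !coef_scal /= ?scal0 ?scale0r ?addr0.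
Qed.

Lemma tens_x a b c e : Ax k *: Tens a b c e = Tens 0 a 0 c.
Proof.
by congr Tens; rewrite /= !coef_Ax /= ?scal0 ?scal1 ?scale0r ?scale1r ?addr0 ?add0r.
Qed.

Lemma tens_y a b c e : Ay k *: Tens a b c e = Tens 0 0 a b.
Proof.
by congr Tens; rewrite /= !coef_Ay /= ?scal0 ?scal1 ?scale0r ?scale1r ?addr0 ?add0r.
Qed.

End TensorAction.

Section SpecializationStable.
Variables (k : fieldType) (t : k).
Local Notation x := (Ax k).
Local Notation ty := (scal t * Ay k).
Local Notation spec := (spec t).

Lemma zact_tens (X : grmod k) (v : int -> gtens X) n : zact t v n =
  Tens 0 (t00 (v n)) (scal t *: t00 (v (n + 1)))
    (t01 (v n) + scal t *: t10 (v (n + 1))).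
Proof.
rewrite /zact -scalerA; case: (v n) (v (n + 1)) => [a b c e] [a' b' c' e'].
rewrite tens_x tens_y tens_scal !scaler0.
by congr Tens; rewrite /= ?addr0 ?add0r.
Qed.

Lemma spec_tens (X : grmod k) : is_zero (spec (dg0 (gtens X))).
Proof.
apply/spec_zeroP => v [[hv [N bv]] dv].
have {}dv n : zact t v n = 0.
  have /(congr1 (fun w => sgA k n *: w)) := dv n.
  by rewrite /tdif add0r scalerA sgA_sq scale1r scaler0.
(* The parts at x and xy are divided by x. The y-part then comes out right by itself: the cocycle
   condition says t01 (v n) = - t t10 (v (n + 1)), which is what t y contributes, the sign
   alternating. *)
exists (fun n => sgA k n *: (Tens (t10 (v n)) 0 (t11 (v n)) 0 : gtens X)); split.
  split=> [n|]; last by exists N => n /bv ->; rewrite scaler0.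
  rewrite [LHS](@pr_sgA k (gtens X)); congr (_ *: _); have e := hv n.
  by rewrite -[in RHS]e /= /tens_pr /= !raddf0.
have sc (a : A k) n (w : gtens X) : a *: (sgA k n *: w) = sgA k n *: (a *: w).
  by rewrite !scalerA mulrC.
move=> n; rewrite /tdif add0r /zact sgAS scaleNr scalerN !sc -scalerBr.
rewrite scalerA sgA_sq scale1r -scalerA tens_x tens_y tens_scal.
have := dv n; rewrite zact_tens; case: (v n) => a b c e [-> _ /eqP] /=.
rewrite addr_eq0 => /eqP ->; rewrite !scaler0.
by congr Tens; rewrite /= ?oppr0 ?addr0 ?add0r.
Qed.

Lemma spec_retract_tens (P : grmod k) (s : grhom P (gtens P)) :
  (forall p, tens_mul (s p) = p) -> is_zero (spec (dg0 P)).
Proof.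
move=> sK; have hF := spec_functor t; have hE := sqcat_preadditive.
have e : fmor spec (dg0_hom (gtens_mul P)) ∘ fmor spec (dg0_hom s) ≈ idm (spec (dg0 P)).
  apply: (heq_trans hE (heq_sym hE (fmor_comp hF _ _))).
  by apply: (heq_trans hE (fmor_heq hF _) (fmor_id hF _)) => p /=; rewrite sK.
exact: (zero_retract hE e (@spec_tens P)).
Qed.

Lemma spec_greg : is_zero (spec (dg0 (greg k))).
Proof.
(* The splitting of the multiplication is a |-> 1 (x) a. *)
pose s (a : greg k) : gtens (greg k) := (a : A k) *: Tens (1 : (A k)^o) 0 0 0.
have sl : linear s by move=> a u v; rewrite /s scalerDl scalerA.
have sp n v : pr n (s v) = s (pr n v).
  have e m c : A_pr m (scal c) = scal (if m == 0 then c else 0) :> A k.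
    apply: coefA_eqP; rewrite coef_A_pr !coef_scal //=; case: eqP => // _; exact: if_same.
  have sE a : s a = @Tens k (greg k) (scal (coefA 0 0 a)) (scal (coefA 1 0 a)) (scal (coefA 0 1 a))
      (scal (coefA 1 1 a)).
    congr Tens; rewrite /= ?scaler0 ?addr0 ?add0r; exact: mulr1.
  rewrite !sE /= /tens_pr /= !e !coef_A_pr oppr0.
  by have -> : (n + 1 == 0) = (n == - 1%:Z) by rewrite addr_eq0.
apply: (@spec_retract_tens _ (GrHom sl sp)) => a.
rewrite /= /s linearZ /= /tens_mul /= !scaler0 !addr0; exact: mulr1.
Qed.

(** [projective] provides lifts only along surjections between finitely generated modules, so
    splitting P (x) A -> P requires this. *)
Lemma fingen_gtens (X : grmod k) : fingen X -> fingen (gtens X).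
Proof.
move=> [s hs].
pose S := [seq (Tens (m *: v) 0 0 0 : gtens X) | m <- [:: 1; Ax k; Ay k; Ax k * Ay k], v <- s].
have h (v : X) : in_span S (Tens v 0 0 0 : gtens X).
  have [c ->] := hs v.
  have -> : Tens (\sum_(i < size s) c i *: s`_i) 0 0 0 =
      \sum_(i < size s) (Tens (c i *: s`_i) 0 0 0 : gtens X).
    elim/big_rec2: _ => [|i y1 y2 _ <-] //; congr Tens; by rewrite /= addr0.
  apply: in_span_sum => i; rewrite (A_basis (c i)) !scalerDl -!scalerA.
  have hS m : m \in [:: 1; Ax k; Ay k; Ax k * Ay k] ->
      in_span S (Tens (m *: s`_i) 0 0 0 : gtens X).
    by move=> hm; apply/in_span_mem/allpairsP; exists (m, s`_i); rewrite mem_nth.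
  have hc (d : k) (u : X) : in_span S (Tens u 0 0 0 : gtens X) ->
      in_span S (Tens (scal d *: u) 0 0 0 : gtens X).
    by move=> /(in_spanZ (scal d)); rewrite tens_scal !scaler0.
  have hD (u w : X) : in_span S (Tens u 0 0 0 : gtens X) ->
      in_span S (Tens w 0 0 0 : gtens X) -> in_span S (Tens (u + w) 0 0 0 : gtens X).
    move=> hu hw; have := in_spanD hu hw; congr in_span.
    by congr Tens; rewrite /= addr0.
  rewrite -[X in scal _ *: X + _ + _ + _]scale1r !scalerA -!scalerA.
  by do 3?[apply: (hD)]; apply: hc; rewrite ?scalerA; apply: hS; rewrite !inE eqxx ?orbT.
exists S => -[a b c e].
have -> : Tens a b c e = Tens a 0 0 0 + Ax k *: Tens b 0 0 0 + Ay k *: Tens c 0 0 0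
    + Ax k *: (Ay k *: Tens e 0 0 0) :> gtens X.
  by rewrite !(tens_x, tens_y); congr Tens; rewrite /= ?addr0 ?add0r.
by do 3?[apply: in_spanD]; do 2?[apply: in_spanZ]; apply: h.
Qed.

Lemma spec_projective (P : fgmod k) : projective P -> is_zero (spec (dg0 P)).
Proof.
move=> hP; have [|s hs] := hP (FgMod (fingen_gtens (fgcarP P))) P (gtens_mul P) (gid P).
  by move=> p; exists (Tens p 0 0 0); rewrite /= /tens_mul /= !scaler0 !addr0.
exact: spec_retract_tens hs.
Qed.

End SpecializationStable.

(** * Descent to the stable categories *)

Definition iota_comp (k : fieldType) (E : precat) (H : prefun (dgstab k) E) :
    prefun (grstab k) E :=
  @PreFun (grstab k) E (fun X => H (iota k X)) (fun _ _ f => fmor H (fmor (iota k) f)).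

Section StableSpecialization.
Variables (k : fieldType) (t : k).
Local Notation spec := (spec t).

Lemma spec_zerom (X Y : dgcat k) : fmor spec (zerom X Y) ≈ zerom (spec X) (spec Y).
Proof.
exact: (fmor_zero (dgcat_preadditive k) sqcat_preadditive (spec_functor t)).
Qed.

Definition spec_Ddg : prefun (Ddg k) sqcat := lext (@spec_quasi_iso k t).

Lemma spec_Ddg_functor : is_functor spec_Ddg.
Proof. exact: (lext_functor sqcat_preadditive (spec_functor t) spec_zerom). Qed.

Lemma spec_Ddg_cone (X Y : Ddg k) (f : Mor X Y) (Z : Ddg k) :
  Ddg_cone f Z -> is_zero (spec_Ddg Z) <-> is_iso (fmor spec_Ddg f).
Proof.
apply: (loc_cone_zero sqcat_preadditive spec_Ddg_functor) => {}X {}Y {}f _ ->.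
exact: cone_zeroP.
Qed.

Lemma spec_perfect (X : Ddg k) : perfect X -> is_zero (spec_Ddg X).
Proof.
elim=> {X} [|n X _|X Y Z f cZ _ X0 _ Y0|X Y i r ri _ Y0].
- exact: spec_greg.
- exact: spec_shift_zero.
- by apply/(spec_Ddg_cone cZ)/zero_iso => //; apply: sqcat_preadditive.
- have hF := spec_Ddg_functor; have hE := sqcat_preadditive.
  apply: (zero_retract hE (i := fmor spec_Ddg i) (r := fmor spec_Ddg r)) Y0.
  apply: (heq_trans hE (heq_sym hE (fmor_comp hF _ _))).
  exact: (heq_trans hE (fmor_heq hF ri) (fmor_id hF _)).
Qed.

Definition spec_Db : prefun (Dbdg k) sqcat :=
  @PreFun (Dbdg k) sqcat (fun X => spec_Ddg (sval X)) (fun _ _ f => fmor spec_Ddg f).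

Lemma spec_Db_functor : is_functor spec_Db.
Proof.
have hF := spec_Ddg_functor.
split=> [X Y f g|X|X Y Z g f|X Y f g].
- exact: (fmor_heq hF).
- exact: (fmor_id hF).
- exact: (fmor_comp hF).
- exact: (fmor_add hF).
Qed.

Lemma spec_Wperf (X Y : Dbdg k) (f : Mor X Y) : Wperf f -> is_iso (fmor spec_Db f).
Proof. by move=> [Z [cZ pZ]]; apply/(spec_Ddg_cone cZ)/spec_perfect. Qed.

Definition spec_dgstab : prefun (dgstab k) sqcat :=
  lext spec_Wperf.

Lemma spec_dgstab_functor : is_functor spec_dgstab.
Proof. have h0 (X Y : Dbdg k) : fmor spec_Db (zerom X Y) ≈ zerom (spec_Db X) (spec_Db Y).
  exact: spec_zerom.
exact: (lext_functor sqcat_preadditive spec_Db_functor h0 spec_Wperf). Qed.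

Lemma spec_dgstab_cone (X Y : dgstab k) (f : Mor X Y) (Z : dgstab k) :
  dgstab_cone f Z -> is_zero (spec_dgstab Z) <-> is_iso (fmor spec_dgstab f).
Proof.
apply: (loc_cone_zero sqcat_preadditive spec_dgstab_functor) => {}X {}Y {}f {}Z.
exact: spec_Ddg_cone.
Qed.

Definition spec_gr : prefun (grstab k) sqcat :=
  iota_comp spec_dgstab.

(** Stable equality is respected because the difference of two stably equal maps factors through a
    projective P: the image of a cocycle in P is a coboundary, and so is its image in Y. *)
Lemma spec_gr_functor : is_functor spec_gr.
Proof.
have hF := spec_functor t; have hE := sqcat_preadditive.
split=> [X Y f g [P [hP [u [v e]]]]|X|X Y Z g f|X Y f g].
- move=> a ca; have [h _] := spec_zeroP t (dg0 P).
  have [w [cw ew]] := h (@spec_projective k t P hP) _ (sqfun_cyc (spec_mor t (dg0_hom u)) ca).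
  exists (fun n => v (w n)); split; first exact: cochain_map.
  by move=> n; rewrite !fctE (tdif_map t (dg0_hom v)) -ew e.
- exact: (fmor_id hF).
- exact: (fmor_comp hF (dg0_hom g) (dg0_hom f)).
- exact: (fmor_add hF (dg0_hom f) (dg0_hom g)).
Qed.

End StableSpecialization.

Section Rescaling.
Variables (k : fieldType) (X : grmod k).
Implicit Types (t l : k) (v : int -> X).

Definition rescale l v (n : int) : X := scal (l ^ n) *: v n.

Lemma cochain_rescale l v : cochain v -> cochain (rescale l v).
Proof.
move=> [hv [N bv]]; split=> [n|]; first by rewrite pr_scal hv.
by exists N => n /bv; rewrite /rescale => ->; rewrite scaler0.
Qed.

(** The y-term reads degree n + 1 and contributes one extra factor l, which is absorbed into t. This
    is where d = 0 matters: a differential would read degree n - 1 and scale differently. *)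
Lemma tdif_rescale t l v n : l != 0 ->
  tdif (X := dg0 X) t (rescale l v) n = scal (l ^ n) *: tdif (X := dg0 X) (t * l) v n.
Proof.
move=> l0; rewrite /tdif !add0r /zact /rescale.
rewrite [RHS]scalerA [scal (l ^ n) * _]mulrC -[RHS]scalerA; congr (_ *: _).
rewrite scalerDr !scalerA; congr (_ *: _ + _ *: _); first exact: mulrC.
by rewrite expfzDr // expr1z !scalM !mulrA [LHS](ACl (3*1*4*2)).
Qed.

Lemma spec_rescale t t' : t != 0 -> t' != 0 ->
  is_zero (spec t (dg0 X)) -> is_zero (spec t' (dg0 X)).
Proof.
move=> t0 t'0; rewrite !spec_zeroP => h v [cv dv].
have l0 : t / t' != 0 by rewrite mulf_neq0 ?invr_eq0.
have l'0 : t' / t != 0 by rewrite mulf_neq0 ?invr_eq0.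
have e (a b : k) : a != 0 -> a * (b / a) = b by move=> a0; rewrite mulrC divfK.
have [|w [cw ew]] := h (rescale (t' / t) v).
  split; first exact: cochain_rescale.
  by move=> n; rewrite tdif_rescale // e // dv scaler0.
exists (rescale (t / t') w); split; first exact: cochain_rescale.
move=> n; rewrite tdif_rescale // e // -ew /rescale scalerA -scalM -[t' / t]invf_div.
by rewrite exprz_inv -expfzDr // subrr expr0z scal1 scale1r.
Qed.

End Rescaling.

(** * The connecting morphism on cochains *)

Lemma linv_comp (C : precat) (W : forall X Y : C, Mor X Y -> Prop) (X Y Z : C)
    (b : lhom W X Z) (q : Mor X Y) (Wq : W X Y q) :
  leq_hom (lcomp (lcomp b (linv Wq)) (lbase W q)) b.
Proof.
apply: leq_trans (leq_sym (leq_compA _ _ _)) _.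
apply: leq_trans (leq_comp (leq_refl b) (leq_invl Wq)) _; exact: leq_comp1r.
Qed.

Section DeltaCochain.
Variables (k : fieldType) (t : k) (X : grmod k).

(* (v_n (x) 1, delta_cochain v n) is the cocycle of omega_cone X above v. *)
Definition delta_cochain (v : int -> X) (n : int) : gshift 1 (gomega X) :=
  sgA k n *: (ogen 0 (v (n + 1)) + ogen 1 (scal t *: v (n + 1 + 1))).

(** The snake construction: v (x) 1 lifts v, and its coboundary lies in Omega X. Sign and index
    shift come from the cocycle equation of the cone. Only the coefficient at 1 uses that v is a
    cocycle. *)
Lemma oval_delta_cochain (v : int -> X) n : tcyc (X := dg0 X) t v ->
  gomega_inc X (delta_cochain v n) =
  - tdif (X := dg0 (gtens X)) t (fun i => Tens (v i) 0 0 0) (n + 1).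
Proof.
move=> [_ dv]; rewrite /tdif add0r zact_tens linearZ /= sgAS scaleNr opprK.
congr (_ *: _); congr Tens; rewrite /= ?scaler0 ?addr0 ?add0r //.
have /(congr1 (fun w => sgA k (n + 1) *: w)) := dv (n + 1).
rewrite /tdif add0r scalerA sgA_sq scale1r scaler0 /zact => e.
by apply/eqP; rewrite -opprD oppr_eq0 scalerA [Ay k * _]mulrC e.
Qed.

End DeltaCochain.

Section SpecializationDelta.
Variables (k : fieldType) (t : k) (X : fgmod k).
Local Notation delta_cochain := (@delta_cochain k t X).

(** Composing the fraction with its denominator [cone_proj] removes the unspecified inverse chosen
    in [lext_mor]. *)
Lemma spec_delta_proj (z : spec t (omega_cone X)) : cyc z ->
  bnd (fmor (spec_dgstab t) (delta X) (spec_mor t (cone_proj X) z)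
       - spec_mor t (cone_bd X) z).
Proof.
have hF := spec_Ddg_functor t; have hE := sqcat_preadditive.
have := fmor_heq hF (linv_comp (lbase (C := dgcat k) (@quasi_iso k) (cone_bd X))
  (cone_proj_qis X)).
exact.
Qed.

Lemma spec_delta (v : int -> X) : tcyc (X := dg0 X) t v ->
  bnd (fmor (spec_dgstab t) (delta X) v - delta_cochain v).
Proof.
move=> cv; have [[hv [N bv]] dv] := cv.
pose y i : gtens X := Tens (v i) 0 0 0.
pose z i : omega_cone X := (y i, delta_cochain v i).
have cy : cochain y.
  split=> [n|]; first by rewrite /= /tens_pr /= !raddf0 hv.
  by exists N => n /bv; rewrite /y => ->.
have incP i : gomega_inc X (delta_cochain v (i - 1)) = - tdif (X := dg0 (gtens X)) t y i.
  by rewrite oval_delta_cochain // subrK.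
have cz : tcyc (X := omega_cone X) t z.
  split.
    apply/cochain_cone; split=> //=.
    have [hty [M bty]] := cochain_tdif (X := dg0 (gtens X)) t cy.
    split=> [n|]; last first.
      exists M => n /bty e; apply: val_inj.
      by rewrite [LHS]incP e oppr0.
    apply: val_inj; rewrite -[LHS](gfun_pr (gomega_inc X)) -[RHS]/(gomega_inc X _).
    by rewrite incP raddfN; congr (- _); apply: hty.
  move=> n; rewrite cone_tdif.
  have e1 : tdif (X := dg0 (gtens X)) t y n + gomega_inc X (delta_cochain v (n - 1)) = 0.
    by rewrite incP subrr.
  have e2 : tdif (X := dg0 (gomega X)) t (fun i => delta_cochain v (i - 1)) (n + 1) = 0.
    apply: val_inj; rewrite -[LHS](tdif_map t (dg0_hom (gomega_inc X))).
    have -> : (fun i => dg0_hom (gomega_inc X) (delta_cochain v (i - 1))) =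
        (fun i => - tdif (X := dg0 (gtens X)) t y i) by apply: funext => i; apply: incP.
    by rewrite tdifN tdif_tdif oppr0.
  apply: etrans (f_equal2 (fun a b => (a, - b)) e1 e2) _.
  by rewrite oppr0.
have ev : v = spec_mor t (cone_proj X) z.
  by apply: funext => i; rewrite /= /tens_mul /= !scaler0 !addr0.
by have := spec_delta_proj cz; rewrite -[spec_mor t (cone_proj X) z]ev.
Qed.

End SpecializationDelta.

(** * Looping morphisms of the orbit category *)

Existing Class is_preadditive.

Instance heq_equivalence (C : precat) (hC : is_preadditive C) (X Y : C) :
  Equivalence (@heq C X Y).
Proof.
by split; [exact: (heq_refl hC) | exact: (heq_sym hC) | exact: (heq_trans hC)].
Qed.

Instance Cmp_proper (C : precat) (hC : is_preadditive C) (X Y Z : C) :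
  Proper (@heq C Y Z ==> @heq C X Y ==> @heq C X Z) (@Cmp C X Y Z).
Proof. by move=> g g' hg f f' hf; apply: (comp_heq hC). Qed.

Instance addm_proper (C : precat) (hC : is_preadditive C) (X Y : C) :
  Proper (@heq C X Y ==> @heq C X Y ==> @heq C X Y) (@addm C X Y).
Proof. by move=> f f' hf g g' hg; apply: (addm_heq hC). Qed.

Section Action.
Variables (C : precat) (T1 : prefun C C) (T : zaction T1).
Context {hC : is_preadditive C}.

Lemma za_faithful m (X Y : C) (f g : Mor X Y) :
  fmor (T m) f ≈ fmor (T m) g -> f ≈ g.
Proof.
move=> fg; apply: (iso_cancell hC (za_unit_iso T Y)).
rewrite !za_unit_nat; apply: (eqm_compl hC).
apply: (iso_cancelr hC (za_mul_iso T (addNr m) X)).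
rewrite -!za_mul_nat; apply: (eqm_compr hC).
exact: (fmor_heq (za_functor T _) fg).
Qed.

Lemma za_full m (X Y : C) (h : Mor (T m X) (T m Y)) : exists f, fmor (T m) f ≈ h.
Proof.
have [u' [u'u uu']] := za_unit_iso T Y.
have [v' [v'v vv']] := za_mul_iso T (addNr m) X.
have isov' := iso_inv v'v vv'.
pose mu := za_mul T (addNr m).
exists (u' ∘ (mu Y ∘ fmor (T (- m)) h ∘ v' ∘ za_unit T X)).
(* Under T^{-m} T^m = id, f is T^{-m} h by construction; faithfulness of T^{-m} then recovers T^m f
   = h. *)
set f := u' ∘ _; apply: (@za_faithful (- m)).
apply: (iso_cancell hC (za_mul_iso T (addNr m) Y)).
rewrite za_mul_nat; apply: (iso_cancelr hC isov').
rewrite (comp_Kiso hC _ vv'); apply: (iso_cancelr hC (za_unit_iso T X)).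
rewrite -za_unit_nat /f (compA hC) uu' (comp1l hC); reflexivity.
Qed.

(** For n < 0 the object T^n Y has no concrete form; this isomorphism lets a map X -> T^n Y be
    studied after applying Omega(1), and repeating the step reaches exponent 0. *)
Lemma loop_exists n p (e : 1 + n = p) (Y : C) :
  exists m : Mor (T1 (T n Y)) (T p Y), is_iso m /\ m ∘ za_one T (T n Y) ≈ za_mul T e Y.
Proof.
have [o' [o'o oo']] := za_one_iso T (T n Y).
exists (za_mul T e Y ∘ o'); split; last exact: comp_Kiso.
exact: (iso_comp hC (za_mul_iso T e Y) (iso_inv o'o oo')).
Qed.

Lemma loop_faithful (X Y : C) (f g : Mor X Y) : fmor T1 f ≈ fmor T1 g -> f ≈ g.
Proof.
move=> fg; apply: (@za_faithful 1); apply: (iso_cancell hC (za_one_iso T Y)).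
rewrite !za_one_nat fg; reflexivity.
Qed.

Lemma loop_heq (X Y : C) (f g : Mor X Y) : f ≈ g -> fmor T1 f ≈ fmor T1 g.
Proof.
move=> fg; apply: (iso_cancelr hC (za_one_iso T X)).
rewrite -!za_one_nat (fmor_heq (za_functor T 1) fg); reflexivity.
Qed.

Lemma loop_full (X Y : C) (h : Mor (T1 X) (T1 Y)) : exists f, fmor T1 f ≈ h.
Proof.
have [o' [o'o oo']] := za_one_iso T Y.
have [f hf] := za_full (o' ∘ (h ∘ za_one T X)).
exists f; apply: (iso_cancelr hC (za_one_iso T X)).
rewrite -za_one_nat hf (compA hC) oo' (comp1l hC); reflexivity.
Qed.

End Action.

Section OneDim.
Variable k : fieldType.
Implicit Types X Y Z : grstab k.
Let hC := grstab_preadditive k.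

Lemma gscale_heq X Y (c : k) (f g : Mor X Y) :
  f ≈ g -> (gscale c f : Mor X Y) ≈ gscale c g.
Proof.
by move=> fg; apply: (@eqm_compr _ hC X Y Y (gscale c (gid Y)) f g fg).
Qed.

Lemma one_dim_comp X Y Z (m : Mor Y Z) : is_iso m -> one_dim X Y -> one_dim X Z.
Proof.
move=> [m' [m'm mm']] [u [u0 hu]]; exists (m ∘ u); split=> [mu0|f].
  apply: u0; apply: (heq_trans hC (heq_sym hC (comp_isoK hC u m'm))).
  exact: (heq_trans hC (eqm_compr hC m' mu0) (comp_zero hC _ m')).
have [c hc] := hu (m' ∘ f); exists c.
apply: (heq_trans hC (heq_sym hC (comp_isoK hC f mm'))).
apply: (heq_trans hC (eqm_compr hC m hc)).
by apply: stab_eq_ext => x /=; exact: linearZ.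
Qed.

(** Looping is bijective on stable morphisms and linear over k. *)
Lemma one_dim_loop (T : zaction (Omega1 k)) n p (e : 1 + n = p) X Y :
  one_dim (Omega1 k X) (T p Y) -> one_dim X (T n Y).
Proof.
have [m [[m' [m'm mm']] _]] := loop_exists T (hC := hC) e Y.
move=> /(one_dim_comp (iso_inv m'm mm')) [u [u0 hu]].
have [v hv] := loop_full T (hC := hC) u; exists v; split=> [v0|f].
  apply: u0; apply: (heq_trans hC (heq_sym hC hv)).
  apply: (heq_trans hC (loop_heq T (hC := hC) v0)); apply: stab_eq_ext => x.
  by apply: val_inj.
have [c hc] := hu (fmor (Omega1 k) f); exists c.
apply: (loop_faithful T (hC := hC)); apply: (heq_trans hC hc).
apply: (heq_trans hC (gscale_heq c (heq_sym hC hv))); apply: stab_eq_ext => x.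
by apply: val_inj => /=; rewrite tens_scal.
Qed.

End OneDim.

Section PsiLoop.
Variables (k : fieldType) (E : precat) (hE : is_preadditive E).
Variables (H : prefun (dgstab k) E) (hH : is_functor H).
(** Functoriality is asked of the composite with [H], since sending projectives to zero is checked
    after applying H_t. *)
Hypothesis hG : is_functor (iota_comp H).
Variables (T : zaction (Omega1 k)) (psi : psi_family T).
Local Notation G := (iota_comp H).
Let hC := grstab_preadditive k.

(** Since [delta] is inverse to psi_1, naturality gives f = psi_1 (Omega f) delta, and [psi_mul]
    merges psi_n with psi_1. The proof composes with the isomorphism psi_1 on the right, so that
    [delta] cancels. *)
Lemma fmor_psi_loop n p (e : 1 + n = p) (X Y : grstab k) (f : Mor X (T n Y))
    (m : Mor (Omega1 k (T n Y)) (T p Y)) : m ∘ za_one T (T n Y) ≈ za_mul T e Y ->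
  fmor H (psi n Y) ∘ fmor G f ≈
  fmor H (psi p Y) ∘ fmor G (m ∘ fmor (Omega1 k) f) ∘ fmor H (delta X).
Proof.
move=> hm; apply: (iso_cancelr hE (functor_iso hE hH (psi_iso psi 1 X))).
have e1 : fmor G f ∘ fmor H (psi 1 X) ≈ fmor H (psi 1 (T n Y)) ∘ fmor G (fmor (T 1) f).
  rewrite -!(fmor_comp hH); apply: (fmor_heq hH).
  by apply: leq_sym; apply: (psi_nat psi).
have e2 : fmor H (psi n Y) ∘ fmor H (psi 1 (T n Y)) ≈
    fmor H (psi p Y) ∘ fmor G (za_mul T e Y).
  by rewrite -!(fmor_comp hH); apply: (fmor_heq hH); apply: (psi_mul psi).
have e3 : fmor H (delta X) ∘ fmor H (psi 1 X) ≈ fmor G (za_one T X).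
  by rewrite -!(fmor_comp hH); apply: (fmor_heq hH); apply: (psi_one psi).
have e4 : fmor G (m ∘ fmor (Omega1 k) f) ∘ fmor G (za_one T X) ≈
    fmor G (za_mul T e Y) ∘ fmor G (fmor (T 1) f).
  rewrite -!(fmor_comp hG); apply: (fmor_heq hG).
  apply: (heq_trans hC (heq_sym hC (compA hC _ _ _))).
  apply: (heq_trans hC (eqm_compr hC m (heq_sym hC (za_one_nat T f)))).
  apply: (heq_trans hC (compA hC _ _ _)); exact: eqm_compl.
rewrite -(compA hE (fmor H (psi n Y))) e1 (compA hE (fmor H (psi n Y))) e2.
rewrite -(compA hE (fmor H (psi p Y) ∘ _)) e3.
rewrite -!(compA hE (fmor H (psi p Y))) e4; reflexivity.
Qed.

Lemma fmor_psi_unit (X Y : grstab k) (f : Mor X Y) :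
  fmor H (psi 0 Y) ∘ fmor G (za_unit T Y ∘ f) ≈ fmor G f.
Proof.
rewrite (fmor_comp hG) (compA hE).
have -> : fmor H (psi 0 Y) ∘ fmor G (za_unit T Y) ≈ idm (G Y).
  by rewrite -(fmor_comp hH) -(fmor_id hH); apply: (fmor_heq hH); apply: (psi_zero psi).
rewrite (comp1l hE); reflexivity.
Qed.

Lemma fmor_FA_two_comp (X Y : grstab k) (f1 : Mor X (T (-1) Y)) (f2 : Mor X (T (-2) Y)) :
  fmor H (fmor (FA psi) (two_comp f1 f2)) ≈
  addm (fmor H (psi (-1) Y) ∘ fmor G f1) (fmor H (psi (-2) Y) ∘ fmor G f2).
Proof.
have h0 : fmor H (zerom (iota k X) (iota k Y)) ≈ zerom (G X) (G Y).
  apply: (addm_idem hE); rewrite -(fmor_add hH); apply: (fmor_heq hH).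
  exact: leq_add0.
have -> : fmor (FA psi) (two_comp f1 f2) = addm (psi (-1) Y ∘ fmor (iota k) f1)
    (addm (psi (-2) Y ∘ fmor (iota k) f2) (zerom _ _)) by [].
rewrite !(fmor_add hH) !(fmor_comp hH) h0 (addmC hE _ (zerom _ _)) (add0m hE).
reflexivity.
Qed.

End PsiLoop.

Section Deloop.
Variables (k : fieldType) (T : zaction (Omega1 k)).
Let hC := grstab_preadditive k.

Lemma loop_eq0 n p (e : 1 + n = p) (X Y : grstab k) (f : Mor X (T n Y))
    (m : Mor (Omega1 k (T n Y)) (T p Y)) : is_iso m ->
  m ∘ fmor (Omega1 k) f ≈ zerom _ _ -> f ≈ zerom _ _.
Proof.
move=> isom h; apply: (loop_faithful T (hC := hC)).
apply: (heq_trans hC (iso_cancell hC isom (heq_trans hC h (heq_sym hC (comp_zero hC _ m))))).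
by apply: stab_eq_ext => x; apply: val_inj.
Qed.

(** The looped map p is fixed before t; hence the constants read off from it later are the same for
    all specializations. *)
Lemma deloop (X Y : grstab k) (f : Mor X (T (-1) Y)) :
  exists p : Mor (Omega1 k X) Y, (p ≈ zerom _ _ -> f ≈ zerom _ _) /\
    forall t (psi : psi_family T),
      fmor (spec_dgstab t) (psi (-1) Y) ∘ fmor (spec_gr t) f ≈
      fmor (spec_gr t) p ∘ fmor (spec_dgstab t) (delta X).
Proof.
have [m [isom hm]] := loop_exists T (hC := hC) (subrr 1) Y.
have [u [uK Ku]] := za_unit_iso T Y; have isou := iso_inv uK Ku.
exists (u ∘ (m ∘ fmor (Omega1 k) f)); split=> [h|t psi].
  apply: (loop_eq0 (subrr 1) isom).
  exact: (iso_cancell hC isou (heq_trans hC h (heq_sym hC (comp_zero hC _ u)))).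
have hE := sqcat_preadditive; have hH := spec_dgstab_functor t; have hG := spec_gr_functor t.
apply: (heq_trans hE (fmor_psi_loop hE hH hG psi _ hm)); apply: (eqm_compl hE).
apply: (heq_trans hE _ (fmor_psi_unit hE hH hG psi _)); apply: (eqm_compr hE).
by apply: (fmor_heq hG); apply: (heq_sym hC (comp_isoK hC _ Ku)).
Qed.

Lemma two_comp_deloop (X Y : grstab k) (f1 : Mor X (T (-1) Y)) (f2 : Mor X (T (-2) Y)) :
  exists (p1 : Mor (Omega1 k X) Y) (p2 : Mor (Omega1 k (Omega1 k X)) Y),
  [/\ p1 ≈ zerom _ _ -> f1 ≈ zerom _ _, p2 ≈ zerom _ _ -> f2 ≈ zerom _ _ &
    forall t (psi : psi_family T),
      fmor (spec_dgstab t) (fmor (FA psi) (two_comp f1 f2)) ≈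
      addm (fmor (spec_gr t) p1 ∘ fmor (spec_dgstab t) (delta X))
        (fmor (spec_gr t) p2 ∘ fmor (spec_dgstab t) (delta (Omega1 k X))
          ∘ fmor (spec_dgstab t) (delta X))].
Proof.
have [p1 [p10 hp1]] := deloop f1.
have e : 1 + (-2) = -1 :> int by [].
have [m [isom hm]] := loop_exists T (hC := hC) e Y.
have [p2 [p20 hp2]] := deloop (m ∘ fmor (Omega1 k) f2).
exists p1, p2; split=> [//|/p20|t psi]; first exact: loop_eq0.
have hE := sqcat_preadditive; have hH := spec_dgstab_functor t; have hG := spec_gr_functor t.
apply: (heq_trans hE (fmor_FA_two_comp hE hH psi f1 f2)); apply: (addm_heq hE); first exact: hp1.
apply: (heq_trans hE (fmor_psi_loop hE hH hG psi _ hm)); apply: (eqm_compl hE).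
exact: hp2.
Qed.

End Deloop.

(** * The simple module *)

Section SimpleLoops.
Variable k : fieldType.
Local Notation S := (gsimple k).
Local Notation S2 := (gshift 2 S).
Local Notation L X := (gshift 1 (gomega X)).

Lemma simple_scale (a : A k) (v : simple k) : a *: v = (coefA 0 0 a * (v : k) : simple k).
Proof. by []. Qed.

Lemma simple_x (v : simple k) : Ax k *: v = 0.
Proof. by rewrite simple_scale coef_Ax mul0r. Qed.

Lemma simple_y (v : simple k) : Ay k *: v = 0.
Proof. by rewrite simple_scale coef_Ay mul0r. Qed.

Lemma omega_t00 (V : lmodType (A k)) (w : omega V) : t00 (oval w) =
  - (Ax k *: t10 (oval w) + Ay k *: t01 (oval w) + Ax k *: (Ay k *: t11 (oval w))).
Proof.
have /eqP := ovalP w; rewrite /tens_mul -!addrA => /eqP; rewrite addr_eq0 => /eqP ->.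
by rewrite -scalerA !addrA.
Qed.

Lemma omega_simple_t00 (w : omega (simple k)) : t00 (oval w) = 0.
Proof. by rewrite omega_t00 !simple_x simple_y !addr0 oppr0. Qed.

Lemma gfun_degree (X Y : grmod k) (f : grhom X Y) n (v : X) :
  pr n v = v -> (forall u : Y, pr n u = 0) -> f v = 0.
Proof. by move=> hv hY; rewrite -hv -gfun_pr hY. Qed.

Lemma pr_S2 n (u : S2) : n != -2 -> pr n u = 0.
Proof. by move=> n0; rewrite /= -[2]opprK addrC subr_eq0 (negbTE n0). Qed.

(** The generators of Omega X attached to xy are redundant: they come from those attached to x and
    y. *)
Lemma y_ogen0 (X : grmod k) (v : X) :
  Ay k *: ogen 0 v = ogen 2 v - ogen 1 (Ax k *: v).
Proof.
apply: val_inj; rewrite /= tens_y; congr Tens; rewrite /= ?oppr0 ?addr0 ?add0r //.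
by rewrite opprK -scalerA scalerA mulrC -scalerA addNr.
Qed.

Lemma pr_ogen0 (X : grmod k) n (v : X) : pr n v = v ->
  pr (g := gomega X) n (ogen 0 v) = ogen 0 v.
Proof.
move=> hv; apply: val_inj; rewrite /= /tens_pr /= !raddf0 raddfN /= pr_x hv //.
Qed.

Lemma pr_ogen1 (X : grmod k) n (v : X) : pr (n + 1) v = v ->
  pr (g := gomega X) n (ogen 1 v) = ogen 1 v.
Proof.
move=> hv; apply: val_inj; rewrite /= /tens_pr /= !raddf0 raddfN /= pr_y hv //.
Qed.

Lemma gfun_ogen2 (X : grmod k) m n (f : grhom (gshift m (gomega X)) (gshift n S)) (v : X) :
  f (ogen 2 v) = f (ogen 1 (Ax k *: v)).
Proof.
apply/eqP; rewrite -subr_eq0 -raddfB /= -y_ogen0 linearZ; apply/eqP; exact: simple_y.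
Qed.

(* Through Omega, f_{-1} and f_{-2} correspond to nonzero multiples of eta and
   of xi2. *)
Definition eta : grhom (L S) S2.
Proof.
refine (@GrHom k (L S) S2 (fun w : omega (simple k) => t01 (oval w)) _ _).
  move=> a u v; rewrite [LHS]/=.
  by rewrite omega_simple_t00 scaler0 addr0 simple_scale coef_scal.
by move=> n w; rewrite /= addrAC.
Defined.

Lemma oval_x (X : grmod k) (w : omega X) :
  oval (Ax k *: w) = Tens 0 (t00 (oval w)) 0 (t01 (oval w)).
Proof. by rewrite /= -(tens_x _ (t10 (oval w)) _ (t11 (oval w))); case: (oval w). Qed.

Lemma oval_y (X : grmod k) (w : omega X) :
  oval (Ay k *: w) = Tens 0 0 (t00 (oval w)) (t10 (oval w)).
Proof. by rewrite /= -(tens_y _ _ (t01 (oval w)) (t11 (oval w))); case: (oval w). Qed.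

(** This makes [xi2] linear: the term t00 is the only one that could contribute to t10 of a multiple
    beyond the scalar part of the action. *)
Lemma omega2_simple_t00 (w : omega (omega (simple k))) : t10 (oval (t00 (oval w))) = 0.
Proof.
rewrite omega_t00.
have D (u v : omega (simple k)) : t10 (oval (u + v)) = t10 (oval u) + t10 (oval v) by [].
have N (u : omega (simple k)) : t10 (oval (- u)) = - t10 (oval u) by [].
rewrite N !D !(oval_x (X := S)) (oval_y (X := S)) !omega_simple_t00.
by rewrite !addr0 oppr0.
Qed.

Definition xi2 : grhom (L (L S)) S2.
Proof.
refine (@GrHom k (L (L S)) S2
  (fun w : omega (omega (simple k)) => t10 (oval (t10 (oval w)))) _ _).
  move=> a u v; rewrite [LHS]/= omega2_simple_t00 (omega_simple_t00 (t00 (oval u))) !scaler0 !addr0.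
  by rewrite !simple_scale !coef_scal /= !mul0r !addr0. 
by move=> n w; rewrite /= addrA.
Defined.

Lemma eta_span (f : grhom (L S) S2) : exists c : k, forall w, f w = gscale c eta w.
Proof.
exists (f (ogen (X := S) 1 (1 : simple k))) => w; rewrite {1}(omega_gens w) !raddfD /=.
(* The generator attached to x has degree -1 in Omega S(1), while S(2) lives in degree -2. *)
have f0 v : f (ogen (X := S) 0 v) = 0.
  apply: (@gfun_degree _ _ f (-1)) => [|u]; last exact: pr_S2.
  exact: (@pr_ogen0 S 0 v erefl).
rewrite f0 gfun_ogen2 simple_x ogen0 raddf0 addr0 add0r.
have {1}-> : t01 (oval w) = scal (t01 (oval w) : k) *: (1 : simple k).
  by rewrite simple_scale coef_scal /= mulr1.
by rewrite ogenZ linearZ /= !simple_scale !coef_scal mulrC.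
Qed.

Lemma xi2_span (f : grhom (L (L S)) S2) : exists c : k, forall w, f w = gscale c xi2 w.
Proof.
pose o2 (a : simple k) : omega (omega (simple k)) := ogen (X := L S) 0 (ogen (X := S) 0 a).
exists (f (o2 1)) => w.
have f0 n (v : L S) : n != -1 -> pr n v = v -> f (ogen (X := L S) 0 v) = 0.
  move=> hn hv; apply: (@gfun_degree _ _ f (n - 1)) => [|u].
    rewrite /= addrC subrK; exact: (pr_ogen0 (X := L S)).
  by apply: pr_S2; rewrite subr_eq.
have f1 n (v : L S) : n != 0 -> pr n v = v -> f (ogen (X := L S) 1 v) = 0.
  move=> hn hv; apply: (@gfun_degree _ _ f (n - 2)) => [|u].
    apply: (pr_ogen1 (X := L S)); rewrite (_ : 1 + (n - 2) + 1 = n) //; lia.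
  by apply: pr_S2; rewrite subr_eq.
have d0 v : pr (g := L S) (-1) (ogen 0 v) = ogen 0 v := @pr_ogen0 S 0 v erefl.
have d1 v : pr (g := L S) (-2) (ogen 1 v) = ogen 1 v := @pr_ogen1 S (-1) v erefl.
have d2 v : pr (g := L S) (-2) (ogen 2 v) = ogen 2 v.
  have e : ogen 2 v = Ay k *: ogen 0 v by rewrite y_ogen0 simple_x ogen0 subr0.
  by rewrite e pr_y (d0 v).
(* By degrees, the y-generators could only be detected on degree 0 of Omega S(1), which lives in
   degrees -1 and -2. *)
have f1E (v : L S) : f (ogen (X := L S) 1 v) = 0.
  rewrite [v](omega_gens (X := S)) !ogenD !raddfD /=.
  by rewrite (f1 _ _ _ (d0 _)) // (f1 _ _ _ (d1 _)) // (f1 _ _ _ (d2 _)) // !addr0.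
rewrite [w in LHS](omega_gens (X := L S)) !raddfD /= gfun_ogen2 !f1E !addr0.
rewrite {1}[t10 _](omega_gens (X := S)) !ogenD !raddfD /=.
rewrite (f0 _ _ _ (d1 _)) // (f0 _ _ _ (d2 _)) // !addr0.
have {1}-> : t10 (oval (t10 (oval w))) = scal (t10 (oval (t10 (oval w))) : k) *: (1 : simple k).
  by rewrite simple_scale coef_scal /= mulr1.
by rewrite !ogenZ linearZ /= !simple_scale !coef_scal mulrC.
Qed.

End SimpleLoops.

(** * The two loop classes on the cohomology of S *)

Section SimpleSpecialization.
Variables (k : fieldType) (t : k).
Local Notation S := (gsimple k).
Local Notation L X := (gshift 1 (gomega X)).
Local Notation S2 := (gshift 2 S).
Local Notation FS := (fgsimple k : grstab k).
Local Notation FS2 := (fgshift 2 (fgsimple k) : grstab k).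

Section TrivialAction.
Variable X : grmod k.
Hypotheses (x0 : forall v : X, Ax k *: v = 0) (y0 : forall v : X, Ay k *: v = 0).

Lemma tdif_triv (v : int -> X) n : tdif (X := dg0 X) t v n = 0.
Proof. by rewrite /tdif add0r /zact -scalerA y0 x0 scaler0 addr0 scaler0. Qed.

Lemma tcyc_triv (v : int -> X) : tcyc (X := dg0 X) t v <-> cochain v.
Proof. by split=> [[]//|cv]; split=> // n; apply: tdif_triv. Qed.

Lemma tbnd_triv (v : int -> X) : tbnd (X := dg0 X) t v <-> (forall n, v n = 0).
Proof. by split=> [[w [_ e]] n|]; [rewrite e tdif_triv | exact: (@tbnd0 k t (dg0 X) v)]. Qed.

End TrivialAction.

Definition tcyc_S := @tcyc_triv S (@simple_x k) (@simple_y k).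
Definition tbnd_S := @tbnd_triv S (@simple_x k) (@simple_y k).
Definition tbnd_S2 := @tbnd_triv S2 (@simple_x k) (@simple_y k).

Lemma cochain_simple (v : int -> S) n : cochain v -> n != 0 -> v n = 0.
Proof. by move=> [hv _] n0; rewrite -hv /= (negbTE n0). Qed.

Lemma eta_delta (v : int -> S) n : cochain v ->
  eta k (delta_cochain t v n) = scal t *: v (n + 1 + 1).
Proof.
move=> cv; rewrite /delta_cochain linearZ raddfD /= scaler0 add0r.
have [n2|n2] := eqVneq (n + 1 + 1) 0; last by rewrite (cochain_simple cv n2) !scaler0.
(* The only surviving degree is even, so the sign of [delta_cochain] is +1. *)
have -> : n = -2 by lia.
by rewrite /sgA /= sqrrN expr1n scale1r.
Qed.

Lemma sgA_scal n : sgA k n = scal ((-1) ^+ `|n|%N).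
Proof.
by rewrite /sgA; elim: `|n|%N => [|m IH]; rewrite ?scal1 // !exprS scalM IH scalN1.
Qed.

Lemma t10_delta (X : grmod k) (v : int -> X) n :
  t10 (oval (delta_cochain t v n)) = sgA k n *: v (n + 1).
Proof.
by rewrite /delta_cochain sgA_scal /= !coef_scal /= scal0 !scale0r !addr0.
Qed.

(** The two connecting maps carry the signs of consecutive degrees, whose product is -1; this is the
    origin of the minus sign in c1 t - c2. *)
Lemma xi2_delta (v : int -> S) n : cochain v ->
  xi2 k (delta_cochain t (delta_cochain t v) n) = - v (n + 1 + 1).
Proof.
move=> cv; have e (X : grmod k) m (w : omega X) :
    t10 (oval (sgA k m *: w)) = sgA k m *: t10 (oval w).
  by rewrite sgA_scal /= !coef_scal /= scal0 scale0r addr0.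
have h : t10 (oval (t10 (oval (delta_cochain (X := L S) t (delta_cochain t v) n)))) =
    - v (n + 1 + 1).
  by rewrite t10_delta (e S) t10_delta scalerA sgAS mulrN sgA_sq scaleN1r.
exact: h.
Qed.

Lemma cyc_bnd (U : sqgrp) (u u' : U) : cyc u -> bnd (u - u') -> cyc u'.
Proof. by move=> cu /bnd_cyc cuu'; rewrite -[u'](subKr u); apply: cycB. Qed.

Lemma comp_bnd (U V W : sqcat) (f : Mor U V) (g : Mor V W) (u : U) (v : V) (w : W) :
  cyc u -> bnd (f u - v) -> bnd (g v - w) -> bnd ((g ∘ f) u - w).
Proof.
move=> cu fu gv; have cfu := sqfun_cyc f cu; apply: bnd_trans gv.
exact: (sqfun_bnd g cfu (cyc_bnd cfu fu) fu).
Qed.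

Lemma spec_gr_bnd (X Y : grstab k) (p q : Mor X Y) (u : spec_gr t X) (v : spec_gr t Y) :
  p ≈ q -> cyc u -> (forall n, q (u n) = v n) -> bnd (fmor (spec_gr t) p u - v).
Proof.
move=> pq cu e; apply: bnd_trans (fmor_heq (spec_gr_functor t) pq u cu) _.
by apply: tbnd0 => n; apply/eqP; rewrite subr_eq0; apply/eqP/e.
Qed.

Definition stab_eta : Mor (Omega1 k FS) FS2 := eta k.
Definition stab_xi2 : Mor (Omega1 k (Omega1 k FS)) FS2 := xi2 k.

Lemma stab_span (X Y : grstab k) (p f : Mor X Y) :
  (exists c : k, forall w, f w = gscale c p w) -> exists c : k, f ≈ gscale c p.
Proof. by move=> [c hc]; exists c; apply: stab_eq_ext. Qed.

Lemma stab_eta_span : forall f : Mor (Omega1 k FS) FS2, exists c, f ≈ gscale c stab_eta.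
Proof.
suff h : forall f : grhom (L S) S2,
  exists c, (f : Mor (Omega1 k FS) FS2) ≈ gscale c stab_eta by exact h.
by move=> f; apply: stab_span; apply: eta_span.
Qed.

Lemma stab_xi2_span : forall f : Mor (Omega1 k (Omega1 k FS)) FS2,
  exists c, f ≈ gscale c stab_xi2.
Proof.
suff h : forall f : grhom (L (L S)) S2,
  exists c, (f : Mor (Omega1 k (Omega1 k FS)) FS2) ≈ gscale c stab_xi2 by exact h.
by move=> f; apply: stab_span; apply: xi2_span.
Qed.

Definition shift_scale (c : k) (v : int -> S) (n : int) : S2 := scal c *: v (n + 1 + 1).

Lemma stab_eta_delta (v : int -> S) n : cochain v ->
  stab_eta (delta_cochain (X := FS) t v n) = shift_scale t v n.
Proof. exact: eta_delta. Qed.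

Lemma stab_xi2_delta (v : int -> S) n : cochain v ->
  stab_xi2 (delta_cochain (X := Omega1 k FS) t (delta_cochain (X := FS) t v) n) =
  shift_scale (- 1) v n.
Proof. by rewrite /shift_scale scalN1 scaleN1r; exact: xi2_delta. Qed.

Lemma spec_eta (c : k) (p : Mor (Omega1 k FS) FS2) (v : spec_gr t FS) :
  p ≈ gscale c stab_eta -> cyc v ->
  bnd ((fmor (spec_gr t) p ∘ fmor (spec_dgstab t) (delta FS)) v
    - (shift_scale (c * t) v : spec_gr t FS2)).
Proof.
move=> pc cv; have h := spec_delta cv; apply: (comp_bnd cv h).
have cd := cyc_bnd (sqfun_cyc (fmor (spec_dgstab t) (delta FS)) cv) h.
apply: (spec_gr_bnd pc cd) => n.
have -> : shift_scale (c * t) v n = scal c *: (scal t *: v (n + 1 + 1) : S2).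
  by rewrite scalerA -scalM.
by rewrite -(eta_delta n (proj1 cv)).
Qed.

Lemma spec_xi2 (c : k) (p : Mor (Omega1 k (Omega1 k FS)) FS2) (v : spec_gr t FS) :
  p ≈ gscale c stab_xi2 -> cyc v ->
  bnd ((fmor (spec_gr t) p ∘ fmor (spec_dgstab t) (delta (Omega1 k FS))
        ∘ fmor (spec_dgstab t) (delta FS)) v
    - (shift_scale (- c) v : spec_gr t FS2)).
Proof.
move=> pc cv; have h := spec_delta cv; apply: (comp_bnd cv h).
have cd := cyc_bnd (sqfun_cyc (fmor (spec_dgstab t) (delta FS)) cv) h.
have h2 := spec_delta (X := Omega1 k FS) cd; apply: (comp_bnd cd h2).
have cd2 := cyc_bnd (sqfun_cyc (fmor (spec_dgstab t) (delta (Omega1 k FS))) cd) h2.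
apply: (spec_gr_bnd pc cd2) => n.
have -> : shift_scale (- c) v n = scal c *: (- v (n + 1 + 1) : S2).
  by rewrite /shift_scale -mulrN1 scalM scalN1 -scalerA scaleN1r.
by rewrite -(xi2_delta n (proj1 cv)).
Qed.

End SimpleSpecialization.

(** * Nonvanishing of the two classes and the cone of g *)

Section OneDimLoops.
Variable k : fieldType.
Local Notation FS := (fgsimple k : grstab k).
Local Notation FS2 := (fgshift 2 (fgsimple k) : grstab k).

Definition unit_cochain (n : int) : gsimple k := if n == 0 then (1 : k) else 0.

Lemma cochain_unit : cochain unit_cochain.
Proof.
split=> [n|]; first by rewrite /= /unit_cochain; case: eqP.
by exists 0 => n n0; rewrite /unit_cochain gt_eqF.
Qed.

Lemma cyc_FS t (v : spec_gr t FS) : cyc v <-> cochain (v : int -> gsimple k).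
Proof. exact: tcyc_S. Qed.

Lemma bnd_FS t (v : spec_gr t FS) : bnd v <-> (forall n, v n = 0).
Proof. exact: tbnd_S. Qed.

Lemma bnd_FS2 t (v : spec_gr t FS2) : bnd v <-> (forall n, v n = 0).
Proof. exact: tbnd_S2. Qed.

Lemma tcyc_unit (t : k) : cyc (s := spec_gr t FS) unit_cochain.
Proof. exact/cyc_FS/cochain_unit. Qed.

Lemma shift_scale_eq0 c : (forall n, shift_scale c unit_cochain n = 0) -> c = 0.
Proof.
move=> /(_ (-2)); rewrite /shift_scale simple_scale coef_scal /=.
by rewrite mulr1.
Qed.

Lemma spec_shift_scale_iso (t c : k) (g : Mor (spec_gr t FS) (spec_gr t FS2)) :
  (forall v, cyc v -> bnd (g v - (shift_scale c v : spec_gr t FS2))) ->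
  is_iso g <-> c != 0.
Proof.
move=> hg; have gE v n : cyc v -> g v n = shift_scale c v n.
  by move=> /hg/bnd_FS2/(_ n)/eqP; rewrite subr_eq0 => /eqP.
rewrite sq_isoP; split=> [[inj _]|c0].
  apply/eqP => c0; have cu := tcyc_unit t.
  have h : bnd (g unit_cochain).
    by apply/bnd_FS2 => n; rewrite (gE _ _ cu) c0 /shift_scale scal0 scale0r.
  have /bnd_FS/(_ 0)/eqP := inj _ cu h.
  by rewrite /unit_cochain eqxx oner_eq0.
split=> [v cv /bnd_FS2 bgv|v cv].
  apply/bnd_FS => n; have := bgv (n - 1 - 1).
  rewrite (gE _ _ cv) /shift_scale !subrK simple_scale coef_scal /=.
  by move/eqP; rewrite mulf_eq0 (negbTE c0) => /eqP.
have [hv [N bv]] := proj1 cv.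
pose u (n : int) : gsimple k := scal c^-1 *: (v (n - 1 - 1) : gsimple k).
have cu : cyc (s := spec_gr t FS) u.
  apply/cyc_FS; split=> [n|].
    rewrite pr_scal /u; congr (_ *: _); have := hv (n - 1 - 1).
    by rewrite [X in X -> _]/= (_ : 2 + (n - 1 - 1) = n); last lia.
  by exists (N + 2) => n hn; rewrite /u bv ?scaler0 //; lia.
exists u => //; apply/bnd_FS2 => n; apply/eqP; rewrite subr_eq0; apply/eqP.
by rewrite (gE _ _ cu) /shift_scale /u scalerA -scalM divff // scal1 scale1r !addrK.
Qed.

Lemma spec_gr_eq0 t (X : grstab k) (p : Mor X FS2) (u : spec_gr t X) n :
  p ≈ zerom X FS2 -> cyc u -> p (u n) = 0.
Proof.
move=> p0 cu; have := (bnd_FS2 _).1 (fmor_heq (spec_gr_functor t) p0 _ cu) n.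
by move/eqP; rewrite subr_eq0 => /eqP.
Qed.

(** A stably trivial map acts as zero on cohomology, whereas [eta] after [delta] multiplies by t;
    hence the choice t = 1. *)
Lemma eta_neq0 : ~ stab_eta k ≈ zerom (Omega1 k FS) FS2.
Proof.
move=> eta0; have cv := tcyc_unit 1; have h := spec_delta cv.
have cd := cyc_bnd (sqfun_cyc (fmor (spec_dgstab 1) (delta FS)) cv) h.
have e n : shift_scale 1 unit_cochain n = 0.
  exact: (etrans (esym (stab_eta_delta 1 n cochain_unit)) (spec_gr_eq0 n eta0 cd)).
by have /eqP := shift_scale_eq0 e; rewrite oner_eq0.
Qed.

Lemma xi2_neq0 : ~ stab_xi2 k ≈ zerom (Omega1 k (Omega1 k FS)) FS2.
Proof.
move=> xi0; have cv := tcyc_unit 1; have h := spec_delta cv.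
have cd := cyc_bnd (sqfun_cyc (fmor (spec_dgstab 1) (delta FS)) cv) h.
have h2 := spec_delta (X := Omega1 k FS) cd.
have cd2 := cyc_bnd (sqfun_cyc (fmor (spec_dgstab 1) (delta (Omega1 k FS))) cd) h2.
have e n : shift_scale (- 1) unit_cochain n = 0.
  exact: (etrans (esym (stab_xi2_delta 1 n cochain_unit)) (spec_gr_eq0 n xi0 cd2)).
by have /eqP := shift_scale_eq0 e; rewrite oppr_eq0 oner_eq0.
Qed.

Lemma one_dim_eta : one_dim (Omega1 k FS) FS2.
Proof.
exists (stab_eta k); split; first exact: eta_neq0.
exact: stab_eta_span.
Qed.

Lemma one_dim_xi2 : one_dim (Omega1 k (Omega1 k FS)) FS2.
Proof.
exists (stab_xi2 k); split; first exact: xi2_neq0.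
exact: stab_xi2_span.
Qed.

Lemma one_dim_unit (T : zaction (Omega1 k)) (X Y : grstab k) :
  one_dim X Y -> one_dim X (T 0 Y).
Proof. exact: one_dim_comp (za_unit_iso T Y). Qed.

Variables (T : zaction (Omega1 k)) (psi : psi_family T).

Lemma one_dim_hom1 : one_dim FS (T (-1) FS2).
Proof. exact: (one_dim_loop (subrr 1) (one_dim_unit T one_dim_eta)). Qed.

Lemma one_dim_hom2 : one_dim FS (T (-2) FS2).
Proof.
have e : 1 + (-2) = -1 :> int by [].
exact: (one_dim_loop e (one_dim_loop (subrr 1) (one_dim_unit T one_dim_xi2))).
Qed.

Lemma spec_g_iso (f1 : Mor FS (T (-1) FS2)) (f2 : Mor FS (T (-2) FS2)) :
  ~ f1 ≈ zerom _ _ -> ~ f2 ≈ zerom _ _ ->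
  exists c1 c2 : k, [/\ c1 != 0, c2 != 0 &
    forall t, is_iso (fmor (spec_dgstab t) (fmor (FA psi) (two_comp f1 f2))) <->
      c1 * t - c2 != 0].
Proof.
move=> f10 f20; have [p1 [p2 [hp1 hp2 hp]]] := two_comp_deloop f1 f2.
have [c1 hc1] := stab_eta_span p1; have [c2 hc2] := stab_xi2_span p2.
have hC := grstab_preadditive k.
have gscale0 (X Y : grstab k) (p q : Mor X Y) : p ≈ gscale 0 q -> p ≈ zerom X Y.
  by move/(heq_trans hC); apply; apply: stab_eq_ext => w; rewrite /= scal0 scale0r.
exists c1, c2; split=> [||t].
- by apply/eqP => c0; apply/f10/hp1/(gscale0 _ _ _ (stab_eta k)); rewrite -c0.
- by apply/eqP => c0; apply/f20/hp2/(gscale0 _ _ _ (stab_xi2 k)); rewrite -c0.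
apply: spec_shift_scale_iso => v cv.
apply: bnd_trans (hp t psi v cv) _.
have := bnd_add (spec_eta hc1 cv) (spec_xi2 hc2 cv).
have -> : (shift_scale (c1 * t - c2) v : spec_gr t FS2) =
    (shift_scale (c1 * t) v : spec_gr t FS2) + (shift_scale (- c2) v : spec_gr t FS2).
  by apply: funext => n; rewrite /shift_scale scalD scalerDl.
exact.
Qed.

(** An object of the essential image is isomorphic to some [dg0 X], because F_A is the identity on
    objects; [spec_rescale] then applies. *)
Lemma not_ess_image (K : dgstab k) (t t' : k) : t != 0 -> t' != 0 ->
  is_zero (spec_dgstab t K) -> ~ is_zero (spec_dgstab t' K) -> ~ ess_image (FA psi) K.
Proof.
move=> t0 t'0 z nz [X [f isof]]; apply: nz.
have hE := sqcat_preadditive.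
have iso s : isomorphic (spec_dgstab s (iota k X)) (spec_dgstab s K).
  by exists (fmor (spec_dgstab s) f); apply: (functor_iso hE (spec_dgstab_functor s)).
apply/(zero_isomorphic hE (iso t')).
apply: (spec_rescale t0 t'0); exact/(zero_isomorphic hE (iso t)).
Qed.

Lemma cone_not_ess_image (f1 : Mor FS (T (-1) FS2)) (f2 : Mor FS (T (-2) FS2)) :
  (2%:R : k) != 0 -> ~ f1 ≈ zerom _ _ -> ~ f2 ≈ zerom _ _ ->
  forall K : dgstab k, dgstab_cone (fmor (FA psi) (two_comp f1 f2)) K ->
    ~ ess_image (FA psi) K.
Proof.
move=> k2 f10 f20 K cK; have [c1 [c2 [c10 c20 h]]] := spec_g_iso f10 f20.
have r0 : c2 / c1 != 0 by rewrite mulf_neq0 ?invr_eq0.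
have e : c1 * (c2 / c1) = c2 by rewrite mulrC divfK.
(* At c2 / c1 the scalar c1 t - c2 vanishes; at twice that value it equals c2. Both parameters are
   nonzero, as rescaling requires. *)
apply: (@not_ess_image K (2%:R * (c2 / c1)) (c2 / c1)) => //; first exact: mulf_neq0.
  apply/(spec_dgstab_cone _ cK)/h; rewrite mulrCA e mulr_natl mulr2n addrK //.
by move/(spec_dgstab_cone _ cK)/h; rewrite e subrr eqxx.
Qed.

End OneDimLoops.

(** * An object outside the essential image *)

(* The string module e -x-> y <-y- 1 -x-> x, as coordinates on the basis
   1, x, y, e, with the differential d e = x. *)
Definition strmod (k : fieldType) : Type := (k * k * k * k)%type.
HB.instance Definition _ (k : fieldType) := GRing.Zmodule.on (strmod k).

Section StringModule.
Variable k : fieldType.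

Definition str (a b p q : k) : strmod k := (a, b, p, q).

Definition str_act (c : A k) (v : strmod k) : strmod k :=
  let: (a, b, p, q) := v in
  str (coefA 0 0 c * a) (coefA 0 0 c * b + coefA 1 0 c * a)
    (coefA 0 0 c * p + coefA 0 1 c * a + coefA 1 0 c * q) (coefA 0 0 c * q).

Fact str_actA a b v : str_act a (str_act b v) = str_act (a * b) v.
Proof.
by case: v => [[[a1 b1] p] q]; rewrite /str_act /str !coefAM; congr (_, _, _, _); ring.
Qed.
Fact str_act1 : left_id 1 str_act.
Proof.
by case=> [[[a b] p] q]; rewrite /str_act !coefA_1 /= !mul0r !mul1r !addr0.
Qed.
Fact str_actDr : right_distributive str_act +%R.
Proof.
move=> c [[[a b] p] q] [[[a' b'] p'] q']; rewrite /str_act /str.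
by congr (_, _, _, _); rewrite /=; ring.
Qed.
Fact str_actDl v : {morph str_act^~ v : a b / a + b}.
Proof.
case: v => [[[a1 b1] p] q] a b; rewrite /str_act /str !coefAD.
by congr (_, _, _, _); rewrite /=; ring.
Qed.
HB.instance Definition _ := GRing.Zmodule_isLmodule.Build (A k) (strmod k)
  str_actA str_act1 str_actDr str_actDl.

Definition str_pr (n : int) (v : strmod k) : strmod k :=
  let: (a, b, p, q) := v in
  str (if n == 0 then a else 0) (if n == 0 then b else 0)
    (if n == -1 then p else 0) (if n == -1 then q else 0).

Definition gstr : grmod k.
Proof.
refine (@GrMod k (strmod k) str_pr _ _ _ _).
- move=> n [[[a b] p] q] [[[a' b'] p'] q']; rewrite /str_pr /str.
  by congr (_, _, _, _); case: ifP; rewrite ?subrr.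
- move=> m n [[[a b] p] q]; rewrite /str_pr /str.
  have [->|mn] := eqVneq m n; first by congr (_, _, _, _); case: (_ == _).
  rewrite [RHS](_ : _ = str 0 0 0 0) // /str.
  congr (_, _, _, _); case: eqP => // em; case: eqP => // en; by rewrite em en eqxx in mn.
- move=> [[[a b] p] q]; exists [:: 0; -1] => //; rewrite !big_cons big_nil addr0.
  by rewrite /str_pr /str; congr (_, _, _, _); rewrite /= ?addr0 ?add0r.
- move=> m n c [[[a b] p] q] hc; rewrite ![_ *: _]/(str_act _ _) /str_pr /str_act /str.
  have c0 i : n != 0 -> coefA i 0 c = 0.
    by move=> h; apply/eqP; apply: contraNT h => /hc ->.
  have c1 i : n != -1 -> coefA i 1 c = 0.
    by move=> h; apply/eqP; apply: contraNT h => /hc ->.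
  have ifM (b0 : bool) (d d' : k) :
    (if b0 then d * d' else 0) = d * (if b0 then d' else 0) by case: b0; rewrite ?mulr0.
  have ifD (b0 : bool) (d d' : k) : (if b0 then d + d' else 0) =
    (if b0 then d else 0) + (if b0 then d' else 0) by case: b0; rewrite ?addr0.
  rewrite !ifD !ifM.
  have [n0|/c0 n0] := eqVneq n 0.
    by rewrite n0 addr0 !c1 ?n0 // !mul0r.
  rewrite !n0 !mul0r !addr0 !add0r.
  have [n1|/c1 n1] := eqVneq n (-1); last by rewrite n1 !mul0r.
  by rewrite n1; have -> : (m + -1 == -1) = (m == 0) by rewrite addrC -subr_eq0 addrAC subrr add0r.
Defined.

Lemma fingen_gstr : fingen gstr.
Proof.
exists [:: str 1 0 0 0 : gstr; str 0 0 0 1] => -[[[a b] p] q].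
exists (fun i => if i is 0%N then scal a + scal b * Ax k + scal p * Ay k else scal q).
rewrite !big_ord_recl big_ord0 addr0 /= ![_ *: _]/(str_act _ _) /str_act /str.
by congr (_, _, _, _); rewrite /= !coefAE /=; ring.
Qed.

Definition dgstr : dgmod k.
Proof.
refine (@DgMod k gstr (fun v => let: (a, b, p, q) := v in str 0 q 0 0) _ _ _).
- move=> c [[[a b] p] q] [[[a' b'] p'] q']; rewrite ![_ *: _]/(str_act _ _) /str_act /str.
  by congr (_, _, _, _); rewrite /=; ring.
- move=> n [[[a b] p] q]; rewrite /= /str_pr /str /= !if_same.
  by have -> : (n + 1 == 0) = (n == -1) by rewrite addr_eq0.
- by case=> [[[a b] p] q].
Defined.

End StringModule.

(** * Cohomology of the string module *)

Section StringSpecialization.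
Variables (k : fieldType) (t : k).

Lemma tdif_str (v : int -> dgstr k) n : tdif t v n =
  str 0 ((v (n - 1)).2 + (-1) ^+ `|n|%N * (v n).1.1.1)
    ((-1) ^+ `|n|%N * ((v n).2 + t * (v (n + 1)).1.1.1)) 0.
Proof.
rewrite /tdif /zact (sgA_scal k n).
case: (v n) (v (n + 1)) (v (n - 1)) => [[[a b] p] q] [[[a1 b1] p1] q1] [[[a2 b2] p2] q2].
rewrite ![_ *: _]/(str_act _ _) /str_act /str /=.
by congr (_, _, _, _); rewrite /= !coefAE /=; ring.
Qed.

Definition str_cochain (a q : k) (n : int) : dgstr k :=
  if n == 0 then str a 0 0 0 else if n == -1 then str 0 0 0 q else 0.

Lemma cochain_str a q : cochain (str_cochain a q).
Proof.
split=> [n|].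
  rewrite /str_cochain; have [->//|n0] := eqVneq n 0.
  by have [->//|n1] := eqVneq n (-1); rewrite raddf0.
by exists 0 => n n0; rewrite /str_cochain !gt_eqF //; lia.
Qed.

(** The perturbed differential sends the span of 1 and e to that of x and y by a matrix of
    determinant t - 1, so t = 1 is the one exceptional parameter. *)
Lemma tdif_str_cochain a q n : tdif t (str_cochain a q) n =
  str 0 (if n == 0 then q + a else 0) (if n == -1 then - (q + t * a) else 0) 0.
Proof.
have e1 m : (str_cochain a q m).1.1.1 = if m == 0 then a else 0.
  by rewrite /str_cochain; case: eqP => //; case: eqP.
have e2 m : (str_cochain a q m).2 = if m == -1 then q else 0.
  by rewrite /str_cochain; case: eqP => [->//|_]; case: eqP.
rewrite tdif_str !e1 !e2 addr_eq0 subr_eq addNr.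
have [->|n0] := eqVneq n 0; first by congr (_, _, _, _); rewrite /=; ring.
have [->|n1] := eqVneq n (-1); first by congr (_, _, _, _); rewrite /=; ring.
by congr (_, _, _, _); ring.
Qed.

Lemma spec_str_nonzero : t = 1 -> ~ is_zero (spec t (dgstr k)).
Proof.
(* The class of 1 - e is nonzero because no coboundary has a coefficient at 1. *)
move=> t1 /spec_zeroP /(_ (str_cochain 1 (- 1))) [|w [_ /(_ 0)]].
  split; first exact: cochain_str.
  by move=> n; rewrite tdif_str_cochain t1 mul1r addNr oppr0 !if_same.
rewrite tdif_str => /(congr1 (fun u : strmod k => u.1.1.1)) /eqP.
by rewrite /= oner_eq0.
Qed.

Lemma spec_str_zero : t != 1 -> is_zero (spec t (dgstr k)).
Proof.
move=> t1; apply/spec_zeroP => v [[hv _] dv].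
have t10 : t - 1 != 0 by rewrite subr_eq0.
have [b eb] : exists b, (v 0).1.1.2 = b by eexists.
have [p ep] : exists p, (v (-1)).1.2 = p by eexists.
have [a ea] : exists a, (v 0).1.1.1 = a by eexists.
have [q eq] : exists q, (v (-1)).2 = q by eexists.
have h0 : q + a = 0.
  by have := congr1 (fun u : strmod k => u.1.1.2) (dv 0); rewrite tdif_str /= ea eq mul1r.
have h1 : q + t * a = 0.
  have := congr1 (fun u : strmod k => u.1.2) (dv (-1)); rewrite tdif_str /= ea eq mulN1r.
  by move/eqP; rewrite oppr_eq0 => /eqP.
have a0 : a = 0.
  have : (t - 1) * a = (q + t * a) - (q + a) by ring.
  rewrite h0 h1 subrr.
  by move/eqP; rewrite mulf_eq0 (negbTE t10) => /eqP.
have q0 : q = 0 by move: h0; rewrite a0 addr0.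
(* The solution of q + a = b and -(q + t a) = p, with q = b - a. *)
pose a' := - (p + b) / (t - 1).
exists (str_cochain a' (b - a')); split; first exact: cochain_str.
move=> n; rewrite tdif_str_cochain -hv /=.
have [n0|n0] := eqVneq n 0.
  rewrite n0; case: (v 0) ea eb => [[[a1 b1] p1] q1] /= -> ->.
  by rewrite /str_pr /str a0 /= subrK.
have [n1|n1] := eqVneq n (-1).
  rewrite n1; case: (v (-1)) ep eq => [[[a1 b1] p1] q1] /= -> ->.
  rewrite /str_pr /str q0 /=; congr (_, _, _, _).
  by rewrite /a'; field.
by case: (v n) => [[[a1 b1] p1] q1]; rewrite /str_pr /str (negbTE n0) (negbTE n1).
Qed.

End StringSpecialization.

Lemma in_Db_dgstr (k : fieldType) : in_Db (dgstr k : Ddg k).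
Proof.
exists (dgstr k); split; first exact: fingen_gstr.
by exists (lbase _ (idm (dgstr k : dgcat k))), (lbase _ (idm (dgstr k : dgcat k)));
  split; apply: leq_comp1l.
Qed.

Lemma FA_not_ess_surj (k : fieldType) (T : zaction (Omega1 k)) (psi : psi_family T) :
  (2%:R : k) != 0 -> ~ ess_surj (FA psi).
Proof.
move=> k2 /(_ (exist _ _ (in_Db_dgstr k))).
(* The parameters compared are 2, where the cohomology vanishes, and the exceptional value 1. *)
apply: (not_ess_image k2 (oner_neq0 k)); first apply: spec_str_zero.
  by rewrite -subr_eq0 mulr2n addrK oner_eq0.
exact: spec_str_nonzero.
Qed.

Theorem corollary4p10 (R : realType) (T : zaction (Omega1 R[i]))
    (psi : psi_family T) :
  let S : grstab R[i] := fgsimple R[i] in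
  let S2 : grstab R[i] := fgshift 2 S in
  [/\ one_dim S (T (-1) S2), one_dim S (T (-2) S2),
      (forall (f1 : Mor S (T (-1) S2)) (f2 : Mor S (T (-2) S2)),
        ~ f1 ≈ zerom S (T (-1) S2) -> ~ f2 ≈ zerom S (T (-2) S2) ->
        forall K : dgstab R[i],
          dgstab_cone (fmor (FA psi) (two_comp f1 f2)) K ->
          ~ ess_image (FA psi) K) &
      ~ ess_surj (FA psi)].
Proof.
have two : (2%:R : R[i]) != 0 by rewrite pnatr_eq0.
split; [exact: one_dim_hom1 | exact: one_dim_hom2 | | exact: FA_not_ess_surj].
by move=> f1 f2 f10 f20 K; apply: cone_not_ess_image.
Qed.
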